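(* If $\varphi:\mathcal A\to M_m(\mathbb C)$ is a unital linear isometry, then $m\ge n$. If, in addition, the C$^*$-envelope $C^*_e(\varphi(\mathcal A))$ is $*$-isomorphic to $M_n(\mathbb C)$, then there are a unitary $U\in M_m(\mathbb C)$, a positive integer $\ell$, and a unital linear contraction $\psi:\mathcal A\to M_{m-\ell n}(\mathbb C)$ such that $$\varphi(X)=U\big((X\otimes I_\ell)\oplus\psi(X)\big)U^*\quad\text{for every }X\in\mathcal A,$$ where $X\otimes I_\ell$ denotes the direct sum of $\ell$ copies of $X$.
   Context: $S$ denotes the $n\times n$ nilpotent Jordan block with ones on the superdiagonal and zeros elsewhere. $\mathcal A=\{f(S): f\text{ a complex polynomial}\}$ is the algebra of $n\times n$ upper-triangular Toeplitz matrices. Matrix algebras carry the operator norm induced by the Euclidean norm; a linear isometry satisfies $\|\varphi(X)\|=\|X\|$; unital means $\varphi(I)=I$. For a unital subspace $\mathcal S$ of a matrix algebra, its C$^*$-envelope $C^*_e(\mathcal S)$ is the unital C$^*$-algebra (unique up to isomorphism) with a unital complete isometry $\iota:\mathcal S\to C^*_e(\mathcal S)$ whose image generates $C^*_e(\mathcal S)$, such that for every unital complete isometry $\kappa$ of $\mathcal S$ into some $B(H)$ there is a surjective unital $*$-homomorphism $\pi$ from the C$^*$-algebra generated by $\kappa(\mathcal S)$ onto $C^*_e(\mathcal S)$ with $\pi\circ\kappa=\iota$. *)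

(* Defs.v *)
From HB Require Import structures.
From mathcomp Require Import all_boot all_order all_algebra.
From mathcomp Require Import boolp classical_sets reals.
From mathcomp Require Import complex mxtens.
Set Implicit Arguments. Unset Strict Implicit. Unset Printing Implicit Defensive.
Import Order.TTheory GRing.Theory Num.Theory.
Local Open Scope ring_scope.

Section Defs.
Variable R : realType.
Local Notation C := (R[i]).

Definition vnorm (J : finType) (v : J -> C) : R :=
  Num.sqrt (\sum_j (complex.Re (v j) ^+ 2 + complex.Im (v j) ^+ 2)).

Definition opnormF (I J : finType) (A : I -> J -> C) : R :=
  sup [set r : R | exists v : J -> C,
        vnorm v <= 1 /\ r = vnorm (fun i => \sum_j A i j * v j)]%classic.

Definition opnorm (p q : nat) (A : 'M[C]_(p, q)) : R := opnormF (fun i j => A i j).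

(* the norm on M_r(M_m(C)) = M_{rm}(C) *)
Definition ampnorm (r m : nat) (X : 'I_r -> 'I_r -> 'M[C]_m) : R :=
  opnormF (fun (a b : 'I_r * 'I_m) => X a.1 b.1 a.2 b.2).

Definition adj (p q : nat) (A : 'M[C]_(p, q)) : 'M[C]_(q, p) := (map_mx conjc A)^T.

Definition unitary (m : nat) (U : 'M[C]_m) : Prop :=
  U *m adj U = 1%:M /\ adj U *m U = 1%:M.

Definition jordanS (n : nat) : 'M[C]_n := \matrix_(i, j) (j == i.+1 :> nat)%:R.

Definition inToeplitz (n : nat) (X : 'M[C]_n) : Prop :=
  exists f : {poly C},
    X = \sum_(k < size f) f`_k *: iter k (mulmx (jordanS n)) 1%:M.

Definition linear_on (p q : nat) (S : 'M[C]_p -> Prop) (f : 'M[C]_p -> 'M[C]_q) :=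
  forall (a : C) X Y, S X -> S Y -> f (a *: X + Y) = a *: f X + f Y.

Definition isometry_on (p q : nat) (S : 'M[C]_p -> Prop) (f : 'M[C]_p -> 'M[C]_q) :=
  forall X, S X -> opnorm (f X) = opnorm X.

Definition contraction_on (p q : nat) (S : 'M[C]_p -> Prop) (f : 'M[C]_p -> 'M[C]_q) :=
  forall X, S X -> opnorm (f X) <= opnorm X.

Definition ucis_on (p q : nat) (S : 'M[C]_p -> Prop) (f : 'M[C]_p -> 'M[C]_q) :=
  [/\ linear_on S f, f 1%:M = 1%:M &
      forall (r : nat) (X : 'I_r -> 'I_r -> 'M[C]_p),
        (forall i j, S (X i j)) -> ampnorm (fun i j => f (X i j)) = ampnorm X].

(* the (unital) C*-subalgebra of M_q generated by a set T; in finite dimension the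
   generated *-algebra is automatically norm closed *)
Inductive cstar_gen (q : nat) (T : 'M[C]_q -> Prop) : 'M[C]_q -> Prop :=
| cg_gen X : T X -> cstar_gen T X
| cg_one : cstar_gen T 1%:M
| cg_add X Y : cstar_gen T X -> cstar_gen T Y -> cstar_gen T (X + Y)
| cg_scale (a : C) X : cstar_gen T X -> cstar_gen T (a *: X)
| cg_mul X Y : cstar_gen T X -> cstar_gen T Y -> cstar_gen T (X *m Y)
| cg_adj X : cstar_gen T X -> cstar_gen T (adj X).

Definition image_of (p q : nat) (S : 'M[C]_p -> Prop) (f : 'M[C]_p -> 'M[C]_q)
  : 'M[C]_q -> Prop := fun Y => exists2 X, S X & Y = f X.

Definition surj_star_hom_on (k n : nat) (D : 'M[C]_k -> Prop) (pi : 'M[C]_k -> 'M[C]_n) :=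
  [/\ linear_on D pi,
      forall X Y, D X -> D Y -> pi (X *m Y) = pi X *m pi Y,
      forall X, D X -> pi (adj X) = adj (pi X),
      pi 1%:M = 1%:M &
      forall Z : 'M[C]_n, exists2 X, D X & pi X = Z].

(* "C*_e(S) is *-isomorphic to M_n(C)", for a unital subspace S of M_p:
   M_n(C), with a unital complete isometry iota, satisfies the defining property of
   the C*-envelope (the universal property being tested against unital complete
   isometries into matrix algebras M_k(C) = B(C^k)). *)
Definition cenvelope_is_Mn (p : nat) (S : 'M[C]_p -> Prop) (n : nat) : Prop :=
  exists iota : 'M[C]_p -> 'M[C]_n,
    [/\ ucis_on S iota,
        forall Z : 'M[C]_n, cstar_gen (image_of S iota) Z &
        forall (k : nat) (kappa : 'M[C]_p -> 'M[C]_k), ucis_on S kappa ->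
          exists pi : 'M[C]_k -> 'M[C]_n,
            surj_star_hom_on (cstar_gen (image_of S kappa)) pi /\
            forall X, S X -> pi (kappa X) = iota X].

End Defs.

(* Main.v *)
Require Import Defs.
From HB Require Import structures.
From mathcomp Require Import all_boot all_order all_algebra all_solvable all_field.
From mathcomp Require Import boolp classical_sets reals.
From mathcomp Require Import complex mxtens.
From mathcomp Require Import ring lra zify.
Import Order.TTheory GRing.Theory Num.Theory.
Local Open Scope ring_scope.

(** Put [T_k = phi (S^k)] and let [P(z)] be the trigonometric polynomial
    [sum_(k < n) z^k T_k + sum_(0 < k < n) z^-k T_k^*].  A unital isometry preserves
    accretivity, so [P(z) >= 0] on the unit circle because [phi = id] gives a rank one
    positive matrix.  For [0 < a < 1] let [p = (X - a)^(n-1)], [q = (1 - a X)^(n-1)]; the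
    Toeplitz matrix of the Blaschke product [p / q] has norm at least one, so there are
    unit vectors [v, w] with [<phi (p / q) v, w> >= 1].  Averaging
    [<P(z) (q v - p w), q v - p w> / |p|^2] over roots of unity shows that
    [P(z) (q(z) v - p(z) w) = 0] on the circle.

    Take [n + 1] distinct [a_i], with [v_i] the vector obtained from [a_i].  By coprimality
    the polynomial [z^(n-1) <P(z) v_i, v_j>] is divisible by [p_i q_j], hence equals
    [c_ij p_i q_j] for degree reasons.  If [m <= n] the [v_i] are linearly dependent, while
    the [p_i] satisfy a single linear relation, with no zero coefficient; this forces
    [c_ij] to have rank one.  After rescaling the [v_i], [<T_k v_i, v_j>] equals
    [<S^k p_i, p_j>], where [p_i] is read as a coefficient vector, so [m = n] and [phi] is a
    unitary conjugation.

    Applied to [iota o phi], this makes [phi] followed by [C*(phi(A)) -> M_n] a unitary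
    conjugation.  A positive element of maximal rank in the kernel of that homomorphism is
    singular, and a vector in its null space generates a copy of the identity
    representation of [M_n]; already one copy, [l = 1], gives the decomposition. *)

(** * The operator norm *)

Section OperatorNorm.
Variable R : realType.
Local Notation C := R[i].
Set Implicit Arguments. Unset Strict Implicit.

Lemma conjcE (x : C) : conjc x = x^*. Proof. by []. Qed.

Lemma adjE p q (A : 'M[C]_(p, q)) i j : adj A i j = (A j i)^*.
Proof. by rewrite !mxE. Qed.

Lemma adjM p q r (A : 'M[C]_(p, q)) (B : 'M[C]_(q, r)) :
  adj (A *m B) = adj B *m adj A.
Proof. by rewrite /adj map_mxM trmx_mul. Qed.

Lemma adjD p q (A B : 'M[C]_(p, q)) : adj (A + B) = adj A + adj B.
Proof. by rewrite /adj map_mxD linearD. Qed.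

Lemma adjN p q (A : 'M[C]_(p, q)) : adj (- A) = - adj A.
Proof. by apply/matrixP=> i j; rewrite !mxE conjcE rmorphN. Qed.

Lemma adjZ p q (a : C) (A : 'M[C]_(p, q)) : adj (a *: A) = a^* *: adj A.
Proof. by apply/matrixP=> i j; rewrite !mxE conjcE rmorphM. Qed.

Lemma adj0 p q : adj (0 : 'M[C]_(p, q)) = 0.
Proof. by apply/matrixP=> i j; rewrite !mxE conjcE rmorph0. Qed.

Lemma adjK p q (A : 'M[C]_(p, q)) : adj (adj A) = A.
Proof. by apply/matrixP=> i j; rewrite !adjE conjCK. Qed.

Lemma adj1mx p : adj (1%:M : 'M[C]_p) = 1%:M.
Proof.
by apply/matrixP=> i j; rewrite adjE !mxE conjC_nat eq_sym.
Qed.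

Lemma adj_row_mx p q r (A : 'M[C]_(p, q)) (B : 'M[C]_(p, r)) :
  adj (row_mx A B) = col_mx (adj A) (adj B).
Proof. by rewrite /adj map_row_mx tr_row_mx. Qed.

Definition dot p (x y : 'cV[C]_p) : C := (adj y *m x) 0 0.

Lemma dotE p (x y : 'cV[C]_p) : dot x y = \sum_j x j 0 * (y j 0)^*.
Proof. by rewrite /dot mxE; apply: eq_bigr => j _; rewrite adjE mulrC. Qed.

Lemma dotDl p (x y z : 'cV[C]_p) : dot (x + y) z = dot x z + dot y z.
Proof. by rewrite /dot mulmxDr mxE. Qed.
Lemma dotDr p (x y z : 'cV[C]_p) : dot x (y + z) = dot x y + dot x z.
Proof. by rewrite /dot adjD mulmxDl mxE. Qed.
Lemma dotZl p (a : C) (x y : 'cV[C]_p) : dot (a *: x) y = a * dot x y.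
Proof. by rewrite /dot -scalemxAr mxE. Qed.
Lemma dotZr p (a : C) (x y : 'cV[C]_p) : dot x (a *: y) = a^* * dot x y.
Proof. by rewrite /dot adjZ -scalemxAl mxE. Qed.
Lemma dotNl p (x y : 'cV[C]_p) : dot (- x) y = - dot x y.
Proof. by rewrite -scaleN1r dotZl mulN1r. Qed.
Lemma dotNr p (x y : 'cV[C]_p) : dot x (- y) = - dot x y.
Proof. by rewrite -scaleN1r dotZr rmorphN rmorph1 mulN1r. Qed.
Lemma dot0l p (x : 'cV[C]_p) : dot 0 x = 0.
Proof. by rewrite /dot mulmx0 mxE. Qed.
Lemma dot0r p (x : 'cV[C]_p) : dot x 0 = 0.
Proof. by rewrite /dot adj0 mul0mx mxE. Qed.
Lemma dot_suml p I (r : seq I) (P : pred I) (F : I -> 'cV[C]_p) y :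
  dot (\sum_(i <- r | P i) F i) y = \sum_(i <- r | P i) dot (F i) y.
Proof.
by apply: (big_morph (fun x => dot x y)) => [a b|]; rewrite ?dotDl ?dot0l.
Qed.
Lemma dot_sumr p I (r : seq I) (P : pred I) (F : I -> 'cV[C]_p) y :
  dot y (\sum_(i <- r | P i) F i) = \sum_(i <- r | P i) dot y (F i).
Proof.
by apply: (big_morph (dot y)) => [a b|]; rewrite ?dotDr ?dot0r.
Qed.
Lemma dotC p (x y : 'cV[C]_p) : dot y x = (dot x y)^*.
Proof. by rewrite /dot -[_ *m y]adjK adjM adjK adjE. Qed.
Lemma dot_adj p q (A : 'M[C]_(p, q)) x y : dot (A *m x) y = dot x (adj A *m y).
Proof. by rewrite /dot adjM adjK mulmxA. Qed.

Lemma dot_adjr p q (A : 'M[C]_(p, q)) x y : dot (adj A *m x) y = dot x (A *m y).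
Proof. by rewrite dot_adj adjK. Qed.

Lemma dot_ge0 p (x : 'cV[C]_p) : 0 <= dot x x.
Proof. by rewrite dotE sumr_ge0 // => j _; rewrite mul_conjC_ge0. Qed.

Lemma dot_eq0 p (x : 'cV[C]_p) : dot x x = 0 -> x = 0.
Proof.
rewrite dotE => /psumr_eq0P h; apply/matrixP=> i j; rewrite ord1 mxE.
by apply/eqP; rewrite -mul_conjC_eq0 h // => k _; rewrite mul_conjC_ge0.
Qed.

Lemma dot_gt0 p (x : 'cV[C]_p) : x != 0 -> 0 < dot x x.
Proof.
move=> x0; rewrite lt_def dot_ge0 andbT; apply: contra x0 => /eqP h.
by rewrite (dot_eq0 h).
Qed.

Lemma vnorm_ge0 (J : finType) (v : J -> C) : 0 <= vnorm v.
Proof. exact: sqrtr_ge0. Qed.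

Lemma sqr_vnorm (J : finType) (v : J -> C) :
  (vnorm v ^+ 2)%:C%C = \sum_j v j * (v j)^*.
Proof.
rewrite /vnorm sqr_sqrtr; last by rewrite sumr_ge0 // => j _; rewrite addr_ge0 // sqr_ge0.
rewrite raddf_sum /=; apply: eq_bigr => j _.
by rewrite add_Re2_Im2 normCK.
Qed.

Lemma sqr_vnorm_dot p (x : 'cV[C]_p) : (vnorm (fun j => x j 0) ^+ 2)%:C%C = dot x x.
Proof. by rewrite sqr_vnorm dotE. Qed.

Lemma vnorm_eq (J : finType) (u v : J -> C) : u =1 v -> vnorm u = vnorm v.
Proof. by move=> e; rewrite /vnorm; congr Num.sqrt; apply: eq_bigr => j _; rewrite e. Qed.

Lemma vnorm_mulmx p q (A : 'M[C]_(p, q)) (x : 'cV[C]_q) :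
  (vnorm (fun i => \sum_j A i j * x j 0) ^+ 2)%:C%C = dot (A *m x) (A *m x).
Proof.
by rewrite -sqr_vnorm_dot; congr (_%:C%C); congr (_ ^+ 2); apply: vnorm_eq => i; rewrite mxE.
Qed.

(** Diagonalise [adj A *m A] by the spectral theorem: [s ^+ 2] is its largest eigenvalue and [v] a
    unit eigenvector for it. The width [q.+1] ensures that there is an eigenvalue. *)
Lemma singular_max p q (A : 'M[C]_(p, q.+1)) :
  exists2 s : R, 0 <= s & exists v : 'cV[C]_q.+1,
    [/\ dot v v = 1, dot (A *m v) (A *m v) = (s ^+ 2)%:C%C &
        forall x, dot (A *m x) (A *m x) <= (s ^+ 2)%:C%C * dot x x].
Proof.
pose H := adj A *m A.
have Hn : H \is normalmx.
  apply/normalmxP; rewrite /H.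
  have -> : (map_mx Num.conj (adj A *m A)^T) = adj A *m A.
    have -> (B : 'M[C]_q.+1) : map_mx Num.conj B^T = adj B.
      by apply/matrixP=> i j; rewrite !mxE.
    by rewrite adjM adjK.
  by [].
have /orthomx_spectralP := Hn.
have uP := spectral_unitarymx H.
rewrite (invmx_unitary uP).
set P := spectralmx H; set d := spectral_diag H => /= HE.
have PadjE : map_mx Num.conj P^T = adj P by apply/matrixP=> i j; rewrite !mxE.
have PPadj : P *m adj P = 1%:M by rewrite -PadjE; apply/unitarymxP.
have adjPP : adj P *m P = 1%:M by apply: mulmx1C.
have quad x : dot (A *m x) (A *m x) = \sum_i d 0 i * ((P *m x) i 0 * ((P *m x) i 0)^*).
  rewrite -dot_adjr mulmxA -/H {1}HE PadjE -!mulmxA dot_adj adjK dotE.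
  by apply: eq_bigr => i _; rewrite mul_diag_mx mxE mulrA.
pose e i : 'cV[C]_q.+1 := adj P *m delta_mx i 0.
have Pe i : P *m e i = delta_mx i 0 by rewrite /e mulmxA PPadj mul1mx.
have quade i : dot (A *m e i) (A *m e i) = d 0 i.
  rewrite quad (bigD1 i) //= Pe mxE !eqxx /= conjC1 !mulr1 big1 ?addr0 // => j ji.
  by rewrite mxE (negPf ji) !mul0r mulr0.
have d_ge0 i : 0 <= d 0 i by rewrite -quade dot_ge0.
have dR i : (complex.Re (d 0 i))%:C%C = d 0 i by rewrite RRe_real // ger0_real.
have Pdot x : dot (P *m x) (P *m x) = dot x x.
  by rewrite dot_adj mulmxA adjPP mul1mx.
(* The eigenvalues are real by [dR]; real parts are compared because the order on [C] is only
   partial. *)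
pose i0 := [arg max_(i > (ord0 : 'I_q.+1)) complex.Re (d 0 i)]%O.
have i0P i : complex.Re (d 0 i) <= complex.Re (d 0 i0).
  by rewrite /i0; case: arg_maxP => // j _; apply.
have s2 : Num.sqrt (complex.Re (d 0 i0)) ^+ 2 = complex.Re (d 0 i0).
  by rewrite sqr_sqrtr // -ler0c dR.
exists (Num.sqrt (complex.Re (d 0 i0))); first exact: sqrtr_ge0.
exists (e i0); rewrite s2 dR quade; split=> //.
  by rewrite -Pdot Pe dotE (bigD1 i0) //= mxE !eqxx /= conjC1 mulr1 big1 ?addr0 // => j ji;
     rewrite mxE (negPf ji) !mul0r.
move=> x; rewrite quad -[X in _ * X]Pdot dotE mulr_sumr.
apply: ler_sum => i _; rewrite ler_wpM2r ?mul_conjC_ge0 //.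
by rewrite -(dR i) -(dR i0) lecR.
Qed.

Lemma opnorm_singular p q (A : 'M[C]_(p, q.+1)) (s : R) (v : 'cV[C]_q.+1) :
  0 <= s -> dot v v = 1 -> dot (A *m v) (A *m v) = (s ^+ 2)%:C%C ->
  (forall x, dot (A *m x) (A *m x) <= (s ^+ 2)%:C%C * dot x x) -> opnorm A = s.
Proof.
move=> s0 v1 vs hs.
rewrite /opnorm /opnormF.
set E := (X in sup X).
have Eub : ubound E s.
  move=> r [x [x1 ->]].
  rewrite -(@ler_pXn2r _ 2) ?nnegrE ?vnorm_ge0 //.
  rewrite -lecR.
  have -> : (fun i : 'I_p => \sum_j A i j * x j) =
            (fun i => \sum_j A i j * (\col_k x k : 'cV[C]_q.+1) j 0).
    by apply: funext => i; apply: eq_bigr => j _; rewrite mxE.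
  rewrite vnorm_mulmx (le_trans (hs _)) // ler_piMr ?lecR ?ler0c ?sqr_ge0 //.
  rewrite -sqr_vnorm_dot lecR.
  have -> : vnorm (fun j : 'I_q.+1 => (\col_k x k : 'cV[C]_q.+1) j 0) = vnorm x.
    by apply: vnorm_eq => j; rewrite mxE.
  by rewrite expr_le1 ?vnorm_ge0.
have Es : E s.
  exists (fun j => v j 0); split.
    rewrite -(@expr_le1 _ 2) ?vnorm_ge0 // -lecR sqr_vnorm_dot v1.
    by rewrite lexx.
  apply/eqP; rewrite -(@eqrXn2 _ 2) ?vnorm_ge0 //; apply/eqP/complexI.
  by rewrite vnorm_mulmx vs.
by apply/eqP; rewrite eq_le; apply/andP; split;
  [apply: ge_sup => //; exists s | apply: sup_upper_bound => //; split; exists s].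
Qed.

Lemma opnorm_attained p q (A : 'M[C]_(p, q.+1)) :
  exists v : 'cV[C]_q.+1,
    [/\ dot v v = 1, dot (A *m v) (A *m v) = (opnorm A ^+ 2)%:C%C &
        forall x, dot (A *m x) (A *m x) <= (opnorm A ^+ 2)%:C%C * dot x x].
Proof.
have [s s0 [v [v1 vs hs]]] := singular_max A.
by exists v; rewrite (opnorm_singular s0 v1 vs hs).
Qed.

Lemma opnorm_ge0 p q (A : 'M[C]_(p, q)) : 0 <= opnorm A.
Proof.
case: q A => [|q] A.
  rewrite /opnorm /opnormF; set E := (X in sup X).
  suff -> : E = [set 0]%classic by rewrite sup1.
  apply/seteqP; split=> r; last first.
    move=> ->; exists (fun=> 0); split; first by rewrite /vnorm big_ord0 sqrtr0.
    by rewrite /vnorm big1 ?sqrtr0 // => j _; rewrite big_ord0 expr0n addr0.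
  move=> [x [_ ->]] /=.
  by rewrite /vnorm big1 ?sqrtr0 // => j _; rewrite big_ord0 expr0n addr0.
have [s s0 [v [v1 vs hs]]] := singular_max A.
by rewrite (opnorm_singular s0 v1 vs hs).
Qed.

Lemma opnorm_bound p q (A : 'M[C]_(p, q)) x :
  dot (A *m x) (A *m x) <= (opnorm A ^+ 2)%:C%C * dot x x.
Proof.
case: q A x => [|q] A x; last by have [v []] := opnorm_attained A.
by rewrite (thinmx0 A) mul0mx dot0l mulr_ge0 ?dot_ge0 // ler0c sqr_ge0.
Qed.

Lemma opnorm_le p q (A : 'M[C]_(p, q)) (c : R) : 0 <= c ->
  (forall x, dot (A *m x) (A *m x) <= (c ^+ 2)%:C%C * dot x x) -> opnorm A <= c.
Proof.
move=> c0 h; case: q A h => [|q] A h.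
  apply: ge_sup.
    exists 0, (fun=> 0); split; last first.
      by rewrite /vnorm big1 ?sqrtr0 // => j _; rewrite big_ord0 expr0n addr0.
    by rewrite /vnorm big_ord0 sqrtr0.
  move=> r [x [_ ->]].
  by rewrite /vnorm big1 ?sqrtr0 // => j _; rewrite big_ord0 expr0n addr0.
have [v [v1 vs _]] := opnorm_attained A.
by rewrite -(@ler_pXn2r _ 2) ?nnegrE ?opnorm_ge0 // -lecR -vs (le_trans (h v)) // v1 mulr1.
Qed.

Lemma opnorm_pairing p q (A : 'M[C]_(p, q)) : 0 < opnorm A ->
  exists v w, [/\ dot v v = 1, dot w w = 1 & dot (A *m v) w = (opnorm A)%:C%C].
Proof.
case: q A => [|q] A A0.
  have : opnorm A <= 0 by apply: opnorm_le => // x; rewrite (thinmx0 A) mul0mx dot0l expr0n mul0r.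
  by rewrite leNgt A0.
have [v [v1 vs _]] := opnorm_attained A.
have A0' : (opnorm A)%:C%C != 0 :> C by rewrite eq_complex /= eqxx andbT gt_eqF.
exists v, (((opnorm A)%:C%C)^-1 *: (A *m v)).
have cA : ((opnorm A)%:C%C)^* = (opnorm A)%:C%C :> C by rewrite -conjcE conjc_real.
rewrite !(dotZl, dotZr) vs fmorphV /= cA rmorphXn /=; split=> //; by field.
Qed.

(** Through this case [r = 1], a complete isometry is seen to be an isometry. *)
Lemma ampnorm1 p (X : 'M[C]_p) : ampnorm (fun _ _ : 'I_1 => X) = opnorm X.
Proof.
rewrite /ampnorm /opnorm /opnormF; congr sup.
have red (V : nmodType) (F : 'I_1 * 'I_p -> V) : \sum_a F a = \sum_i F (ord0, i).
  rewrite (eq_bigr (fun a => F (a.1, a.2))) => [|[] //].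
  by rewrite -(pair_bigA _ (fun a b => F (a, b))) /= big_ord1.
have vred (v : 'I_1 * 'I_p -> C) : vnorm v = vnorm (fun i => v (ord0, i)).
  by congr Num.sqrt; rewrite red.
apply/seteqP; split=> r [v [v1 ->]].
  exists (fun i => v (ord0, i)); rewrite -vred; split=> //.
  by rewrite vred; apply: vnorm_eq => i /=; rewrite red.
exists (fun a => v a.2); rewrite vred; split=> //.
by rewrite vred; apply: vnorm_eq => i /=; rewrite red.
Qed.

End OperatorNorm.

(** * Toeplitz matrices and positivity of the symbol *)

Section ToeplitzAlgebra.
Variable R : realType.
Local Notation C := R[i].
Set Implicit Arguments. Unset Strict Implicit.

Definition shift n k : 'M[C]_n := iter k (mulmx (jordanS R n)) 1%:M.

Definition toeplitz n (f : {poly C}) : 'M[C]_n :=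
  \sum_(k < size f) f`_k *: shift n k.

Lemma shiftE n k (i j : 'I_n) : shift n k i j = (j == i + k :> nat)%N%:R.
Proof.
elim: k i j => [|k IH] i j; first by rewrite mxE addn0 eq_sym.
rewrite /shift iterS -/(shift n k) mxE.
have [lt|ge] := ltnP i.+1 n.
  rewrite (bigD1 (Ordinal lt)) //= big1 ?addr0 => [|l ne].
    by rewrite mxE eqxx mul1r IH /= addSnnS.
  by rewrite mxE (_ : (l == i.+1 :> nat) = false) ?mul0r //; apply/negbTE.
rewrite big1 => [|l _].
  by rewrite (_ : (j == i + k.+1 :> nat)%N = false) //; have := ltn_ord j; lia.
by rewrite mxE (_ : (l == i.+1 :> nat) = false) ?mul0r //; have := ltn_ord l; lia.
Qed.

Lemma toeplitzE n f (i j : 'I_n) :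
  toeplitz n f i j = if (i <= j)%N then f`_(j - i) else 0.
Proof.
rewrite /toeplitz summxE (eq_bigr (fun k : 'I_(size f) => f`_k * (j == i + k :> nat)%N%:R)).
  2: by move=> k _; rewrite mxE shiftE.
have [le|gt] := leqP i j; last first.
  rewrite big1 // => k _; rewrite (_ : (j == i + k :> nat)%N = false) ?mulr0 //; lia.
have [lt|ge] := ltnP (j - i) (size f).
  rewrite (bigD1 (Ordinal lt)) //= big1 ?addr0 => [|k ne].
    by rewrite (_ : (j == i + (j - i) :> nat)%N) ?mulr1 //; lia.
  rewrite (_ : (j == i + k :> nat)%N = false) ?mulr0 //.
  by apply/negbTE; apply: contra ne => /eqP e; apply/eqP/val_inj => /=; lia.
rewrite nth_default // big1 // => k _.
by rewrite (_ : (j == i + k :> nat)%N = false) ?mulr0 //; have := ltn_ord k; lia.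
Qed.

Lemma toeplitz_lin n (a : C) f g :
  toeplitz n (a *: f + g) = a *: toeplitz n f + toeplitz n g.
Proof.
by apply/matrixP=> i j; rewrite !mxE !toeplitzE; case: ifP; rewrite ?coefD ?coefZ ?mulr0 ?addr0.
Qed.

Lemma toeplitz1 n : toeplitz n 1 = 1%:M.
Proof.
apply/matrixP=> i j; rewrite toeplitzE mxE coef1.
case: ifP => h; last by case: eqP h => // ->; rewrite leqnn.
by congr (_%:R); rewrite -val_eqE /=; lia.
Qed.

Lemma toeplitzXn n k : toeplitz n 'X^k = shift n k.
Proof.
apply/matrixP=> i j; rewrite toeplitzE shiftE coefXn.
case: ifP => h; first by congr (_%:R); lia.
by rewrite (_ : (j == i + k :> nat)%N = false) //; lia.
Qed.

(** Since [S^k = 0] for [k >= n], the range of summation can be made independent of [f]. *)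
Lemma toeplitz_truncE n f : toeplitz n f = \sum_(k < n) f`_k *: shift n k.
Proof.
apply/matrixP=> i j; rewrite toeplitzE summxE.
rewrite (eq_bigr (fun k : 'I_n => f`_k * (j == i + k :> nat)%N%:R)).
  2: by move=> k _; rewrite mxE shiftE.
have [le|gt] := leqP i j; last first.
  rewrite big1 // => k _; rewrite (_ : (j == i + k :> nat)%N = false) ?mulr0 //; lia.
have lt : (j - i < n)%N by have := ltn_ord j; lia.
rewrite (bigD1 (Ordinal lt)) //= big1 ?addr0 => [|k ne].
  by rewrite (_ : (j == i + (j - i) :> nat)%N) ?mulr1 //; lia.
rewrite (_ : (j == i + k :> nat)%N = false) ?mulr0 //.
by apply/negbTE; apply: contra ne => /eqP e; apply/eqP/val_inj => /=; lia.
Qed.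

Lemma inToeplitz_toeplitz n f : inToeplitz (toeplitz n f).
Proof. by exists f. Qed.

Lemma inToeplitz1 n : inToeplitz (1%:M : 'M[C]_n).
Proof. by exists 1; rewrite -/(toeplitz n 1) toeplitz1. Qed.

Lemma inToeplitz_lin n (a : C) (X Y : 'M[C]_n) :
  inToeplitz X -> inToeplitz Y -> inToeplitz (a *: X + Y).
Proof.
move=> [f ->] [g ->]; exists (a *: f + g).
exact/esym/toeplitz_lin.
Qed.

Section Linear.
Variables (n m : nat) (phi : 'M[C]_n -> 'M[C]_m).
Hypothesis phi_lin : linear_on (@inToeplitz R n) phi.

Lemma linear_toeplitz f : phi (toeplitz n f) = \sum_(k < n) f`_k *: phi (shift n k).
Proof.
have in0 : inToeplitz (0 : 'M[C]_n) by exists 0; rewrite size_poly0 big_ord0.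
have phi0 : phi 0 = 0.
  have := phi_lin 1 in0 in0; rewrite !scale1r addr0 => /(congr1 (fun X => X - phi 0)).
  by rewrite addrK subrr.
(* Linearity is assumed only on Toeplitz matrices, so the induction carries membership of the
   partial sums along. *)
suff h N : inToeplitz (\sum_(k < N) f`_k *: shift n k) /\
    phi (\sum_(k < N) f`_k *: shift n k) = \sum_(k < N) f`_k *: phi (shift n k).
  by rewrite toeplitz_truncE; case: (h n).
elim: N => [|N [IH1 IH2]]; first by rewrite !big_ord0.
have inS : inToeplitz (shift n N) by rewrite -toeplitzXn; apply: inToeplitz_toeplitz.
by rewrite !big_ord_recr /= addrC; split; [apply: inToeplitz_lin | rewrite phi_lin // IH2 addrC].
Qed.
End Linear.

End ToeplitzAlgebra.

(** * Accretivity and positivity of the symbol on the unit circle *)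

Section Positivity.
Variable R : realType.
Local Notation C := R[i].
Set Implicit Arguments. Unset Strict Implicit.

Lemma ge0_of_linear_bound (q B : R) : (forall t, 0 < t -> - (t * B) <= q) -> 0 <= q.
Proof.
move=> h; rewrite leNgt; apply/negP => q0.
have B0 : 0 < B by have := h 1 ltr01; nra.
(* For [q < 0] this [t] turns the bound into [q / 2 <= q], which is absurd. *)
have := h (- q / (2 * B)) _.
rewrite divr_gt0 ?oppr_gt0 ?mulr_gt0 // => /(_ isT).
have -> : - (- q / (2 * B) * B) = q / 2 by field; rewrite gt_eqF.
by lra.
Qed.

Lemma ge0_of_quadratic (q : C) (B : R) : q^* = q ->
  (forall t : R, 0 < t -> - (t * B)%:C%C <= q) -> 0 <= q.
Proof.
move=> qR h; have qE : q = (complex.Re q)%:C%C by rewrite RRe_real // CrealE; apply/eqP.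
rewrite qE ler0c; apply: (@ge0_of_linear_bound _ B) => t t0.
by rewrite -lecR rmorphN /= -qE h.
Qed.

Definition psd p (H : 'M[C]_p) := forall x, 0 <= dot (H *m x) x.

(** Moving from [x] to [x - t H x] changes the form by [- 2 t |H x|^2] at first order, which
    positivity forbids for small [t] unless [H x = 0]. *)
Lemma psd_ker p (H : 'M[C]_p) x : adj H = H -> psd H -> dot (H *m x) x = 0 -> H *m x = 0.
Proof.
move=> Hh Hp Hx; set y := H *m x; apply: dot_eq0; apply/eqP; rewrite eq_le dot_ge0 andbT.
rewrite -oppr_ge0; set d := dot y y.
have eR : (complex.Re (dot (H *m y) y))%:C%C = dot (H *m y) y by rewrite RRe_real // ger0_real.
apply: (@ge0_of_quadratic _ (complex.Re (dot (H *m y) y) / 2)).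
  by rewrite rmorphN /= /d -dotC.
move=> t t0; set e := dot (H *m y) y in eR *.
have tC : (t%:C%C)^* = t%:C%C :> C by rewrite -conjcE conjc_real.
have := Hp (x - t%:C%C *: y).
rewrite mulmxBr -scalemxAr !(dotDl, dotDr, dotNl, dotNr, dotZl, dotZr) Hx -/y tC.
have -> : dot (H *m y) x = d by rewrite dot_adj Hh.
rewrite -/d -/e => hh.
have t0' : 0 < t%:C%C :> C by rewrite ltcR.
have {}hh : 0 <= t%:C%C * (t%:C%C * e - 2 * d).
  by apply: le_trans hh _; rewrite le_eqVlt; apply/orP; left; apply/eqP; ring.
move: hh; rewrite pmulr_rge0 // subr_ge0 => hh.
rewrite rmorphM rmorphM /= eR fmorphV rmorph_nat lerNl opprK.
by rewrite mulrA ler_pdivlMr ?ltr0n // mulrC.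
Qed.

Section Isometry.
Variables (n m : nat) (n_gt0 : (0 < n)%N) (phi : 'M[C]_n -> 'M[C]_m).
Hypothesis phi_lin : linear_on (@inToeplitz R n) phi.
Hypothesis phi1 : phi 1%:M = 1%:M.
Hypothesis phi_iso : isometry_on (@inToeplitz R n) phi.

(** Accretivity of [Y] gives [|1 - t Y|^2 <= 1 + t^2 |Y|^2] for [t > 0]. The isometry carries this
    bound over to [phi Y]; its terms of order [t] give the claim as [t] tends to 0. *)
Lemma isometry_accretive (Y : 'M[C]_n) : inToeplitz Y ->
  (forall u, 0 <= dot (Y *m u) u + dot u (Y *m u)) ->
  forall x, 0 <= dot (phi Y *m x) x + dot x (phi Y *m x).
Proof.
move=> YA hY x; set c := opnorm Y.
have xR : (complex.Re (dot x x))%:C%C = dot x x by rewrite RRe_real // ger0_real ?dot_ge0.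
apply: (@ge0_of_quadratic _ (c ^+ 2 * complex.Re (dot x x))).
  by rewrite rmorphD /= -!dotC addrC.
move=> t t0.
have tC : (t%:C%C)^* = t%:C%C :> C by rewrite -conjcE conjc_real.
have t0' : 0 < t%:C%C :> C by rewrite ltcR.
have expand k (Z : 'M[C]_k) (u : 'cV_k) :
  dot ((- t%:C%C *: Z + 1%:M) *m u) ((- t%:C%C *: Z + 1%:M) *m u) =
  dot u u - t%:C%C * (dot (Z *m u) u + dot u (Z *m u)) + t%:C%C ^+ 2 * dot (Z *m u) (Z *m u).
  rewrite mulmxDl mul1mx -scalemxAl !(dotDl, dotDr, dotZl, dotZr) rmorphN /= tC; ring.
have b0 : 0 <= 1 + t ^+ 2 * c ^+ 2 by rewrite addr_ge0 // mulr_ge0 // sqr_ge0.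
have nY : opnorm (- t%:C%C *: Y + 1%:M) <= Num.sqrt (1 + t ^+ 2 * c ^+ 2).
  apply: opnorm_le => [|u]; first exact: sqrtr_ge0.
  rewrite sqr_sqrtr // expand rmorphD rmorphM !rmorphXn /= mulrDl mul1r lerD //.
    by rewrite gerBl mulr_ge0 ?hY // ltW.
  rewrite -[leRHS]mulrA ler_wpM2l ?exprn_ge0 ?(ltW t0') // -rmorphXn; exact: opnorm_bound.
have inT : inToeplitz (- t%:C%C *: Y + 1%:M) by apply: inToeplitz_lin; [|apply: inToeplitz1].
rewrite -phi_iso // (phi_lin _ YA (inToeplitz1 _ _)) phi1 in nY.
have := opnorm_bound (- t%:C%C *: phi Y + 1%:M) x.
have nY2 : opnorm (- t%:C%C *: phi Y + 1%:M) ^+ 2 <= 1 + t ^+ 2 * c ^+ 2.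
  by rewrite -[leRHS]sqr_sqrtr // ler_pXn2r ?nnegrE ?opnorm_ge0 ?sqrtr_ge0.
have := ler_wpM2r (dot_ge0 x) (etrans (lecR _ _) nY2).
move=> h1 h2; have {h1 h2} := le_trans h2 h1.
rewrite expand -xR; set q := dot (_ *m x) x + _; set y := dot (_ *m x) _.
have y0 : 0 <= y by apply: dot_ge0.
rewrite rmorphD rmorphM /= mulrDl mul1r -addrA lerD2l. move=> h.
have {h} : - (t%:C%C * q) <= (t ^+ 2)%:C%C * (c ^+ 2)%:C%C * (complex.Re (dot x x))%:C%C.
  by apply: le_trans h; rewrite lerDl mulr_ge0 // exprn_ge0 // ltW.
rewrite lerNl => h; rewrite -(ler_pM2l t0'); apply: le_trans h.
by rewrite le_eqVlt; apply/orP; left; apply/eqP; rewrite !rmorphM /=; ring.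
Qed.

(* [symb z] is [sum_(k < n) z^k T_k + sum_(0 < k < n) z^-k T_k^*] for [|z| = 1],
   where [T_k = phi (S^k)]. *)
Definition half_symb (z : C) : 'M[C]_m := \sum_(k < n) z ^+ k *: phi (shift R n k).
Definition symb (z : C) : 'M[C]_m := half_symb z + adj (half_symb z) - 1%:M.

Lemma adj_symb z : adj (symb z) = symb z.
Proof. by rewrite /symb !adjD adjN adjK adj1mx [adj _ + _]addrC. Qed.

Lemma symb_psd z : z * z^* = 1 -> psd (symb z).
Proof.
move=> z1 x.
pose f : {poly C} := \poly_(k < n) z ^+ k.
(* The shift by one half makes [Y + Y^*] equal to the symbol of the identity map at [z]. *)
pose Y : 'M[C]_n := (- 2^-1) *: 1%:M + toeplitz n f.
have inT := inToeplitz_toeplitz n f.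
have YA : inToeplitz Y by apply: inToeplitz_lin => //; apply: inToeplitz1.
have phif : phi (toeplitz n f) = half_symb z.
  by rewrite (linear_toeplitz phi_lin); apply: eq_bigr => k _; rewrite coef_poly ltn_ord.
have h2 : (2^-1)^* = 2^-1 :> C by rewrite fmorphV /= conjC_nat.
have phiY : phi Y = (- 2^-1) *: 1%:M + half_symb z.
  by rewrite phi_lin ?phi1 ?phif //; exact: inToeplitz1.
have symbE k (Z : 'M[C]_k) (u : 'cV_k) :
    let W := (- 2^-1) *: 1%:M + Z in
    dot (W *m u) u + dot u (W *m u) = dot ((Z + adj Z - 1%:M) *m u) u.
  rewrite /= !mulmxDl -!scalemxAl mulNmx !mul1mx !(dotDl, dotDr, dotZl, dotZr, dotNl) dot_adjr.
  by rewrite rmorphN /= h2; field.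
have -> : dot (symb z *m x) x = dot (phi Y *m x) x + dot x (phi Y *m x).
  by rewrite phiY symbE.
apply: isometry_accretive => // u; rewrite symbE.
(* The [(i, j)] entry of that symbol is [z^(j - i)], so it is the rank one matrix [e e^*]. *)
pose e : 'cV[C]_n := \col_i (z^* ^+ i).
suff -> : toeplitz n f + adj (toeplitz n f) - 1%:M = e *m adj e.
  by rewrite -mulmxA dot_adj dot_ge0.
apply/matrixP=> i j; rewrite !mxE !big_ord1 conjcE !toeplitzE !mxE conjcE !coef_poly.
rewrite rmorphXn /= conjCK.
have pw a b : (z^* ^+ a) * z ^+ (a + b) = z ^+ b.
  by rewrite exprD mulrA -exprMn mulrC [z^* * z]mulrC z1 expr1n mulr1.
have pw' a b : (z^* ^+ (a + b)) * z ^+ a = z^* ^+ b.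
  by rewrite exprD mulrAC -exprMn [z^* * z]mulrC z1 expr1n mul1r.
have := ltn_ord i; have := ltn_ord j.
case: (ltngtP i j) => h.
- rewrite (_ : (i == j) = false) ?subr0; last by apply/negbTE; rewrite -val_eqE /=; lia.
  move=> jn _; rewrite (_ : (j - i < n)%N) ?rmorph0 ?addr0; last by lia.
  by rewrite -{2}(subnKC (ltnW h)) pw.
- rewrite (_ : (i == j) = false) ?subr0; last by apply/negbTE; rewrite -val_eqE /=; lia.
  move=> jn jn'; rewrite (_ : (i - j < n)%N) ?add0r; last by lia.
  by rewrite -{2}(subnKC (ltnW h)) pw' rmorphXn.
- rewrite (val_inj h) eqxx subnn n_gt0 expr0 rmorph1 addrK => _ _.
  by rewrite -exprMn [z^* * z]mulrC z1 expr1n.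
Qed.

End Isometry.
End Positivity.

(** * The kernel of the symbol *)

Section RootsOfUnity.
Variable C : numClosedFieldType.
Set Implicit Arguments. Unset Strict Implicit.

Lemma prim_root_exists N : (0 < N)%N -> exists z : C, N.-primitive_root z.
Proof.
move=> N0; have [r Dr] := closed_field_poly_normal ('X^N - 1 : {poly C}).
rewrite (monicP _) ?monicXnsubC // scale1r in Dr.
have rN : all N.-unity_root r by apply/allP=> z; rewrite -root_prod_XsubC -Dr.
have szr : (N < (size r).+1)%N by rewrite -(size_prod_XsubC r id) -Dr size_XnsubC.
have [|z _ zN] := hasP (cyclic.has_prim_root N0 rN _ szr); last by exists z.
by rewrite -separable_prod_XsubC -Dr separable_Xn_sub_1 // pnatr_eq0 -lt0n.
Qed.

Lemma unit_root_conj N (z : C) : (0 < N)%N -> z ^+ N = 1 -> z * z^* = 1.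
Proof.
move=> N0 zN; rewrite -normCK; apply/eqP; rewrite sqrp_eq1 // -(@pexpr_eq1 _ `|z| N) //.
by rewrite -normrX zN normr1.
Qed.

(** Orthogonality of characters: for [k != j] the ratio [u] of the geometric sum satisfies [u^N = 1]
    and [u != 1]. The bounds on [k] and [j] exclude distinct exponents that agree modulo [N]. *)
Lemma sum_prim_root N (w : C) k j : N.-primitive_root w -> (k < N)%N -> (j < N)%N ->
  \sum_(l < N) (w ^+ l) ^+ k * ((w ^+ l)^*) ^+ j = N%:R * (k == j)%:R.
Proof.
move=> wN kN jN; have N0 := prim_order_gt0 wN.
have w1 := unit_root_conj N0 (prim_expr_order wN).
set u := w ^+ k * w^* ^+ j.
have -> : \sum_(l < N) (w ^+ l) ^+ k * ((w ^+ l)^*) ^+ j = \sum_(l < N) u ^+ l.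
  apply: eq_bigr => l _; rewrite rmorphXn /= /u exprMn -!exprM.
  by rewrite [(k * l)%N]mulnC [(j * l)%N]mulnC.
have uw : u * w ^+ j = w ^+ k by rewrite /u -mulrA -exprMn [w^* * w]mulrC w1 expr1n mulr1.
have [kj|kj] := eqVneq k j.
  have -> : u = 1 by rewrite /u kj -exprMn w1 expr1n.
  rewrite mulr1 (eq_bigr (fun=> 1)) => [|l _]; last by rewrite expr1n.
  by rewrite sumr_const card_ord.
rewrite mulr0; apply/eqP.
have wcN : w^* ^+ N = 1 by rewrite -rmorphXn /= (prim_expr_order wN) conjC1.
have u1 : u - 1 != 0.
  rewrite subr_eq0; apply: contra kj => /eqP u1; move: uw; rewrite u1 mul1r => /eqP.
  by rewrite (eq_prim_root_expr wN) !modn_small // eq_sym.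
have uN : u ^+ N = 1.
  by rewrite /u exprMn exprAC (prim_expr_order wN) expr1n mul1r exprAC wcN expr1n.
by rewrite -(mulrI_eq0 _ (mulfI u1)) -subrX1 uN subrr.
Qed.

End RootsOfUnity.

(** * Powers of Blaschke factors and their Toeplitz matrices *)

Section BlaschkePower.
Variable R : realType.
Local Notation C := R[i].
Set Implicit Arguments. Unset Strict Implicit.

(* [blaschke_trunc a d K] approximates [pnum a d / pden a d], the [d]-th power of
   the Blaschke factor at [a], by truncating the geometric series of [1 / (1 - a X)]. *)
Definition pnum (a : C) d : {poly C} := ('X - a%:P) ^+ d.
Definition pden (a : C) d : {poly C} := (1 - a *: 'X) ^+ d.
Definition blaschke_trunc (a : C) d K : {poly C} :=
  (('X - a%:P) * \sum_(k < K) (a *: 'X) ^+ k) ^+ d.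

Lemma blaschke_truncE a d K :
  blaschke_trunc a d K * pden a d = pnum a d * (1 - (a *: 'X) ^+ K) ^+ d.
Proof.
rewrite /blaschke_trunc /pden /pnum -!exprMn -mulrA; congr ((_ * _) ^+ _).
by rewrite -[in RHS]opprB subrX1 -mulNr opprB mulrC.
Qed.

(** The extra terms of the geometric series are multiples of [X^n], and [x - y] divides [x^d - y^d].
    Hence all orders [K >= n] give the same [n x n] Toeplitz matrix. *)
Lemma blaschke_trunc_mod a d n K : (n <= K)%N ->
  exists r, blaschke_trunc a d K = blaschke_trunc a d n + 'X^n * r.
Proof.
move=> nK.
pose s : {poly C} := \sum_(i < K - n) a ^+ (n + i) *: 'X^i.
have e : \sum_(k < K) (a *: 'X) ^+ k = \sum_(k < n) (a *: 'X) ^+ k + 'X^n * s :> {poly C}.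
  rewrite -!(big_mkord xpredT (fun k => (a *: 'X) ^+ k)) (big_cat_nat (n := n)) //=.
  congr (_ + _); rewrite -{1}[n]add0n big_addn big_mkord mulr_sumr.
  by apply: eq_bigr => i _; rewrite [(i + n)%N]addnC exprZn ['X^(n + i)]exprD scalerAr.
pose x := ('X - a%:P) * \sum_(k < K) (a *: 'X) ^+ k.
pose y := ('X - a%:P) * \sum_(k < n) (a *: 'X) ^+ k.
exists (('X - a%:P) * s * (\sum_(i < d) x ^+ (d.-1 - i) * y ^+ i)).
apply/eqP; rewrite addrC -subr_eq; apply/eqP.
rewrite /blaschke_trunc -/x -/y subrXX.
have -> : x - y = 'X^n * (('X - a%:P) * s).
  by rewrite /x /y e mulrDr addrAC subrr add0r mulrCA.
by rewrite -!mulrA.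
Qed.

Lemma toeplitz_mod n (f g r : {poly C}) : f = g + 'X^n * r -> toeplitz n f = toeplitz n g.
Proof.
move=> ->; apply/matrixP=> i j; rewrite !toeplitzE; case: ifP => // _.
by rewrite coefD coefXnM (_ : (j - i < n)%N) ?addr0 //; have := ltn_ord j; lia.
Qed.

Lemma pnum_coef a d i : (i <= d)%N -> (pnum a d)`_i = (- a) ^+ (d - i) *+ 'C(d, i).
Proof.
move=> id; rewrite /pnum addrC exprDn coef_sum.
have lt : (i < d.+1)%N by [].
rewrite (bigD1 (Ordinal lt)) //= big1 ?addr0 => [|j ne].
  by rewrite coefMn -polyCN -polyC_exp coefCM coefXn eqxx mulr1.
rewrite coefMn -polyCN -polyC_exp coefCM coefXn (_ : (i == j :> nat)%N = false) ?mulr0 ?mul0rn //.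
by apply/negbTE; apply: contra ne => /eqP e; apply/eqP/val_inj.
Qed.

Lemma pden_coef a d i : (i <= d)%N -> (pden a d)`_i = (- a) ^+ i *+ 'C(d, i).
Proof.
move=> id; rewrite /pden exprDn coef_sum.
have lt : (i < d.+1)%N by [].
rewrite (bigD1 (Ordinal lt)) //= big1 ?addr0 => [|j ne].
  by rewrite coefMn expr1n mul1r -scaleNr exprZn coefZ coefXn eqxx mulr1.
rewrite coefMn expr1n mul1r -scaleNr exprZn coefZ coefXn.
rewrite (_ : (i == j :> nat)%N = false) ?mulr0 ?mul0rn //.
by apply/negbTE; apply: contra ne => /eqP e; apply/eqP/val_inj.
Qed.

(** [pden] is the reversed polynomial [X^d pnum(1 / X)]. *)
Lemma pnum_rev a d i : (i <= d)%N -> (pnum a d)`_(d - i) = (pden a d)`_i.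
Proof.
by move=> id; rewrite pnum_coef ?pden_coef ?leq_subr // subKn // bin_sub.
Qed.

Lemma pden_neq0 a d : pden a d != 0.
Proof.
apply/eqP => h; have := pden_coef a (leq0n d).
by rewrite h coef0 expr0 bin0 => /eqP; rewrite eq_sym oner_eq0.
Qed.

(** With the coefficients listed by decreasing degree, an upper triangular Toeplitz matrix acts as
    multiplication modulo [X^n]. *)
Definition revcol n (q : {poly C}) : 'cV[C]_n := \col_i q`_(n.-1 - i).

Lemma toeplitz_revcol n (f q : {poly C}) : toeplitz n f *m revcol n q = revcol n (f * q).
Proof.
apply/matrixP=> i j; rewrite {j}ord1 !mxE coefM.
pose F k : C := f`_k * q`_(n.-1 - i - k).
rewrite (eq_bigr (fun j : 'I_n => if (i <= j)%N then F (j - i)%N else 0)); last first.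
  move=> j _; rewrite toeplitzE mxE; case: ifP => h; last by rewrite mul0r.
  by rewrite /F (_ : n.-1 - i - (j - i) = n.-1 - j)%N //; have := ltn_ord j; lia.
rewrite -big_mkcond /= -(big_mkord (fun j => i <= j)%N (fun j => F (j - i)%N)).
rewrite -(big_mkord xpredT F).
have lt := ltn_ord i.
rewrite (big_cat_nat (n := i)) //=; last exact: ltnW.
rewrite big1_seq ?add0r; last by move=> j; rewrite mem_index_iota; lia.
rewrite -{1}[nat_of_ord i]add0n big_addn (_ : (n - i = (n.-1 - i).+1)%N); last by lia.
rewrite big_mkcond /=; apply: eq_bigr => j _.
by rewrite leq_addl addnK.
Qed.

Lemma revcol_mod n (f g r : {poly C}) : f = g + 'X^n * r -> revcol n f = revcol n g.
Proof.
move=> ->; apply/matrixP=> i j; rewrite !mxE coefD coefXnM (_ : (n.-1 - i < n)%N) ?addr0 //.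
by have := ltn_ord i; lia.
Qed.

Lemma one_sub_exp_mod (d : nat) (y : {poly C}) :
  exists r, (1 - y) ^+ d = 1 + y * r.
Proof.
exists (- \sum_(i < d) (1 - y) ^+ i).
by rewrite -[LHS](subrK 1) subrX1; ring.
Qed.

(** The matrix sends the vector of [pden] to that of [pnum]. These consist of the same real numbers
    in opposite order, so a nonzero vector keeps its norm. *)
Lemma blaschke_norm_ge1 n a : (0 < n)%N -> a^* = a ->
  1 <= opnorm (toeplitz n (blaschke_trunc a n.-1 n)).
Proof.
move=> n0 aR; set X := toeplitz _ _.
set u := revcol n (pden a n.-1).
have Xu : X *m u = revcol n (pnum a n.-1).
  rewrite toeplitz_revcol blaschke_truncE.
  have [r ->] := one_sub_exp_mod n.-1 ((a *: 'X) ^+ n).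
  rewrite mulrDr mulr1; apply: (@revcol_mod _ _ _ (a ^+ n *: (pnum a n.-1 * r))).
  by rewrite exprZn -scalerAl -!scalerAr mulrCA.
have cN i : (i <= n.-1)%N -> ((pden a n.-1)`_i)^* = (pden a n.-1)`_i.
  by move=> h; rewrite pden_coef // rmorphMn rmorphXn rmorphN /= aR.
have nrm : dot (X *m u) (X *m u) = dot u u.
  rewrite Xu !dotE (reindex_inj rev_ord_inj) /=; apply: eq_bigr => i _.
  have h : (i <= n.-1)%N by have := ltn_ord i; lia.
  rewrite !mxE /= (_ : n.-1 - (n - i.+1) = i)%N; last by have := ltn_ord i; lia.
  by rewrite -pnum_rev ?leq_subr // subKn // .
have u0 : 0 < dot u u.
  have lt : (n.-1 < n)%N by rewrite prednK.
  apply: dot_gt0; apply/eqP => /matrixP /(_ (Ordinal lt) 0).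
  by rewrite !mxE /= subnn pden_coef // expr0 bin0 => /eqP; rewrite oner_eq0.
have := opnorm_bound X u; rewrite nrm ler_pMl // => h.
by rewrite -(@expr_ge1 _ 2) ?opnorm_ge0 // -lecR.
Qed.

End BlaschkePower.

(** * Vectors annihilated by the symbol *)

Section SymbolKernel.
Variable R : realType.
Local Notation C := R[i].
Set Implicit Arguments. Unset Strict Implicit.

Lemma eq0_archimedean (h M : C) n : 0 <= h ->
  (forall j, (n <= j)%N -> j.+1%:R * h <= M) -> h = 0.
Proof.
move=> h0 hM; apply/eqP/negPn/negP => hn0.
have h1 : 0 < h by rewrite lt_def hn0.
have hE : h = (complex.Re h)%:C%C by rewrite RRe_real // ger0_real.
have ME : M = (complex.Re M)%:C%C.
  by rewrite RRe_real // ger0_real // (le_trans _ (hM n _)) // mulr_ge0 // ler0n.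
set x := complex.Re h in hE; set y := complex.Re M in ME.
have x0 : 0 < x by rewrite -ltcR -hE.
have yx k : (n <= k)%N -> k.+1%:R * x <= y.
  by move=> /hM; rewrite hE ME -(rmorph_nat (real_complex R)) -rmorphM /= lecR.
have y0 : 0 <= y by rewrite (le_trans _ (yx n _)) // mulr_ge0 ?ler0n ?ltW.
have := archi_boundP (divr_ge0 y0 (ltW x0)); set b := Num.bound _ => hb.
have := yx (n + b)%N (leq_addr _ _); rewrite leNgt => /negP; apply.
rewrite -ltr_pdivrMr //; apply: lt_le_trans hb _.
by rewrite ler_nat; lia.
Qed.

(** With [K = 2 j], a truncation error of order [2^-K] absorbs the factor [(K + 1) (j + 1)]. *)
Lemma geom_bound j : (j.*2.+1 * j.+1 <= 2 * 2 ^ j.*2)%N.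
Proof.
have h : (j.+1 <= 2 ^ j)%N by apply: ltn_expl.
have -> : (2 ^ j.*2 = 2 ^ j * 2 ^ j)%N by rewrite -addnn expnD.
have : (j.+1 * j.+1 <= 2 ^ j * 2 ^ j)%N by apply: leq_mul.
by lia.
Qed.

Section BlaschkePoints.
Variables (a z : C) (d : nat).
Hypotheses (a0 : 0 < a) (a12 : a <= 2^-1) (z1 : z * z^* = 1).

Let aR : a^* = a.
Proof. by apply/CrealP; rewrite ger0_real // ltW. Qed.

Lemma pnumE : (pnum a d).[z] = (z - a) ^+ d.
Proof. by rewrite /pnum horner_exp !hornerE. Qed.

Lemma pdenE : (pden a d).[z] = (1 - a * z) ^+ d.
Proof. by rewrite /pden horner_exp !hornerE. Qed.

(** On the unit circle conjugation exchanges [pnum] and [pden] up to the factor [z^-d], which makes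
    their quotient unimodular. *)
Lemma conj_pnum : ((pnum a d).[z])^* = z^* ^+ d * (pden a d).[z].
Proof.
rewrite pnumE pdenE rmorphXn rmorphB /= aR -exprMn mulrBr mulr1 mulrCA.
by rewrite [z^* * z]mulrC z1 mulr1.
Qed.

Lemma conj_pden : ((pden a d).[z])^* = z^* ^+ d * (pnum a d).[z].
Proof.
rewrite pnumE pdenE rmorphXn rmorphB rmorphM rmorph1 /= aR -exprMn mulrBr.
by rewrite [z^* * z]mulrC z1 [z^* * a]mulrC.
Qed.

Lemma norm_circle : `|z| = 1.
Proof. by apply/eqP; rewrite -sqrp_eq1 // normCK z1. Qed.

Lemma pnum_neq0 : (pnum a d).[z] != 0.
Proof.
rewrite pnumE expf_neq0 // subr_eq0; apply/negP => /eqP za.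
have := norm_circle; rewrite za gtr0_norm // => a1.
by move: a12; rewrite a1 invf_ge1 ?ltr0n // -[1]/1%:R ler_nat.
Qed.
End BlaschkePoints.

Section Isometry.
Variables (n m : nat) (n_gt0 : (0 < n)%N) (phi : 'M[C]_n -> 'M[C]_m).
Hypothesis phi_lin : linear_on (@inToeplitz R n) phi.
Hypothesis phi1 : phi 1%:M = 1%:M.
Hypothesis phi_iso : isometry_on (@inToeplitz R n) phi.
Local Notation T k := (phi (shift R n k)).

Lemma dot_symb z x y : dot (symb phi z *m x) y =
  \sum_(k < n) z ^+ k * dot (T k *m x) y
  + \sum_(k < n) z^* ^+ k * dot x (T k *m y) - dot x y.
Proof.
rewrite /symb !mulmxDl mulNmx mul1mx !(dotDl, dotNl) dot_adjr.
rewrite /half_symb !mulmx_suml dot_suml dot_sumr.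
congr (_ + _ - _); apply: eq_bigr => k _; rewrite -scalemxAl ?dotZl ?dotZr //.
by rewrite rmorphXn.
Qed.

Lemma phi_shift0 : T 0 = 1%:M. Proof. exact: phi1. Qed.

(** Averaging against the conjugate of [F] extracts the coefficients of nonnegative degree. From the
    adjoint half only [k = 0] survives, and it cancels the subtracted identity. The size condition
    keeps all exponents below [N]. *)
Lemma sum_symb N w (F : {poly C}) x y : N.-primitive_root w -> (size F + n <= N)%N ->
  \sum_(l < N) (F.[w ^+ l])^* * dot (symb phi (w ^+ l) *m x) y =
  N%:R * \sum_(k < n) (F`_k)^* * dot (T k *m x) y.
Proof.
move=> wN sN; set s := size F.
have FE z : (F.[z])^* = \sum_(j < s) (F`_j)^* * z^* ^+ j.
  rewrite horner_coef rmorph_sum; apply: eq_bigr => j _.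
  by rewrite rmorphM rmorphXn.
pose S1 l := \sum_(k < n) \sum_(j < s) (F`_j)^* * dot (T k *m x) y * ((w ^+ l) ^+ k * (w ^+ l)^* ^+ j).
pose S2 l := \sum_(k < n) \sum_(j < s) (F`_j)^* * dot x (T k *m y) * ((w ^+ l) ^+ 0 * (w ^+ l)^* ^+ (j + k)).
pose S3 l := \sum_(j < s) (F`_j)^* * dot x y * ((w ^+ l) ^+ 0 * (w ^+ l)^* ^+ j).
have -> : \sum_(l < N) (F.[w ^+ l])^* * dot (symb phi (w ^+ l) *m x) y =
    \sum_(l < N) (S1 l + S2 l - S3 l).
  apply: eq_bigr => l _; rewrite FE dot_symb mulrBr mulrDr; congr (_ + _ - _).
  - rewrite mulr_sumr; apply: eq_bigr => k _; rewrite mulr_suml; apply: eq_bigr => j _; ring.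
  - rewrite mulr_sumr; apply: eq_bigr => k _; rewrite mulr_suml; apply: eq_bigr => j _.
    by rewrite exprD; ring.
  - rewrite mulr_suml; apply: eq_bigr => j _; ring.
rewrite big_split sumrN big_split /=.
have E1 : \sum_(l < N) S1 l = N%:R * \sum_(k < n) (F`_k)^* * dot (T k *m x) y.
  rewrite exchange_big /= mulr_sumr; apply: eq_bigr => k _.
  rewrite exchange_big /=.
  rewrite (eq_bigr (fun j : 'I_s => (F`_j)^* * dot (T k *m x) y *
    (N%:R * (k == j :> nat)%N%:R))); last first.
    move=> j _; rewrite -mulr_sumr (sum_prim_root wN) //.
      by have := ltn_ord k; lia.
    by have := ltn_ord j; lia.
  have [ks|ks] := ltnP k s.
    rewrite (bigD1 (Ordinal ks)) //= eqxx mulr1 big1 ?addr0 => [|j ne]; first by rewrite mulrC.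
    rewrite (_ : (k == j :> nat)%N = false) ?mulr0 //.
    by apply/negbTE; apply: contra ne => /eqP e; apply/eqP/val_inj.
  rewrite nth_default // rmorph0 mul0r mulr0 big1 // => j _.
  by rewrite (_ : (k == j :> nat)%N = false) ?mulr0 //; have := ltn_ord j; lia.
have -> : \sum_(l < N) S2 l = \sum_(l < N) S3 l.
  rewrite exchange_big /= (bigD1 (Ordinal n_gt0)) //= [X in _ + X]big1 => [|k k0].
    rewrite addr0; apply: eq_bigr => l _; rewrite /S3; apply: eq_bigr => j _ /=.
    by rewrite addn0 (_ : T 0 *m y = y) // phi_shift0 mul1mx.
  rewrite exchange_big big1 //= => j _.
  rewrite -mulr_sumr (sum_prim_root wN); [|by lia|by have := ltn_ord j; have := ltn_ord k; lia].
  rewrite (_ : (0 == j + k)%N = false) ?mulr0 //.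
  by rewrite -val_eqE /= in k0; lia.
by rewrite E1 addrK.
Qed.

Lemma norm_sub_exp (y : C) d : `|y| <= 1 ->
  `|1 - (1 - y) ^+ d| <= `|y| * \sum_(i < d) 2 ^+ i.
Proof.
move=> y1; rewrite -normrN opprB subrX1 addrAC subrr add0r mulNr normrN normrM.
rewrite ler_wpM2l //; apply: le_trans (ler_norm_sum _ _ _) _; apply: ler_sum => i _.
rewrite normrX lerXn2r ?nnegrE ?ler0n //.
by rewrite (le_trans (ler_normB _ _)) // normr1 -[2]/(1 + 1) lerD2l.
Qed.

Lemma symb_kernel (a : C) : 0 < a -> a <= 2^-1 ->
  exists v w : 'cV[C]_m, dot v v = 1 /\
    forall N z, (n <= N)%N -> z ^+ N = 1 ->
      symb phi z *m ((pden a n.-1).[z] *: v - (pnum a n.-1).[z] *: w) = 0.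
Proof.
move=> a0 a12; set d := n.-1.
have aR : a^* = a by apply/CrealP; rewrite ger0_real // ltW.
set X := toeplitz n (blaschke_trunc a d n).
have nX : opnorm (phi X) = opnorm X by apply: phi_iso; apply: inToeplitz_toeplitz.
have X1 : 1 <= opnorm X by apply: blaschke_norm_ge1.
have [|v [w [v1 w1 vw]]] := @opnorm_pairing _ _ _ (phi X).
  by rewrite nX (lt_le_trans ltr01).
exists v, w; split=> // N0 z nN0 zN0.
have z1 : z * z^* = 1 by apply: (@unit_root_conj _ N0) => //; lia.
pose c : C := (opnorm X)%:C%C.
have c1 : 1 <= c by rewrite lecR.
have cR : c^* = c by rewrite -conjcE conjc_real.
(* On the circle [g] is the conjugate of [pnum / pden], hence unimodular, and [h] is nonnegative
   because the symbol is. *)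
pose g (u : C) := (pden a d).[u] / (pnum a d).[u].
pose h (u : C) := dot (symb phi u *m (g u *: v - w)) (g u *: v - w).
have gg (u : C) : u * u^* = 1 -> g u * (g u)^* = 1.
  move=> u1; rewrite /g rmorphM fmorphV /= conj_pnum // conj_pden //.
  have p0 := pnum_neq0 d a0 a12 u1.
  have q0 : (pden a d).[u] != 0.
    by apply: contra p0 => /eqP q0; rewrite -conjC_eq0 conj_pnum // q0 mulr0.
  have u0 : u^* ^+ d != 0.
    rewrite expf_neq0 // conjC_eq0; apply/negP => /eqP e0.
    by move/eqP: u1; rewrite e0 mul0r eq_sym oner_eq0.
  by field; rewrite p0 q0 u0.
have h_ge0 (u : C) : u * u^* = 1 -> 0 <= h u by move=> u1; apply: symb_psd.
(* A vector on which a positive form vanishes lies in its kernel; multiplying by [pnum] then clears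
   the denominator of [g]. *)
suff hz : h z = 0.
  have := psd_ker (adj_symb phi z) (symb_psd n_gt0 phi_lin phi1 phi_iso z1) hz.
  move=> /(congr1 (fun y => (pnum a d).[z] *: y)); rewrite scaler0 => <-.
  rewrite scalemxAr scalerBr scalerA /g mulrC mulfVK //.
  exact: (pnum_neq0 d a0 a12 z1).
pose B := \sum_(k < n) `|dot (T k *m v) w| + \sum_(k < n) `|dot v (T k *m w)| + `|dot v w|.
have B0 : 0 <= B by rewrite !addr_ge0 ?sumr_ge0.
have symbB (u : C) : u * u^* = 1 -> `|dot (symb phi u *m v) w| <= B.
  move=> u1; have nu := norm_circle u1; rewrite dot_symb.
  apply: le_trans (ler_normB _ _) _; rewrite lerD2r.
  apply: le_trans (ler_normD _ _) _; apply: lerD; apply: le_trans (ler_norm_sum _ _ _) _;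
    apply: ler_sum => k _; rewrite normrM normrX ?norm_conjC nu expr1n mul1r //.
pose D : C := \sum_(i < d) 2 ^+ i.
have D0 : 0 <= D by rewrite sumr_ge0 // => i _; rewrite exprn_ge0 ?ler0n.
(* The bound does not depend on [j], while the truncation order [K = 2 j] grows with it. *)
apply: (@eq0_archimedean _ (4 * N0%:R * D * B) n); first exact: h_ge0.
move=> j nj; set K := j.*2.
have nK : (n <= K)%N by rewrite /K; lia.
(* As a multiple of [N0], this [N] makes [z] an [N]-th root of unity; as [n <= N0], it is also large
   enough for [sum_symb] with a truncation of order [K]. *)
set N := (N0 * K.+1)%N.
have N_gt0 : (0 < N)%N by rewrite muln_gt0; lia.
have [om omN] := @prim_root_exists C N N_gt0.
have om1 l : om ^+ l * (om ^+ l)^* = 1.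
  apply: (@unit_root_conj _ N) => //.
  by rewrite exprAC (prim_expr_order omN) expr1n.
have zN : z ^+ N = 1 by rewrite exprM zN0 expr1n.
have [l0 zl0] := prim_rootP omN zN.
set F := blaschke_trunc a d K.
have szF : (size F + n <= N)%N.
  pose G : {poly C} := \sum_(k < K) (a *: 'X) ^+ k.
  have sg : (size G <= K)%N.
    apply: leq_trans (size_sum _ _ _) _; apply/bigmax_leqP => k _.
    rewrite exprZn; apply: leq_trans (size_scale_leq _ _) _.
    by rewrite size_polyXn; have := ltn_ord k.
  have sb : (size (('X - a%:P) * G)%R <= K.+1)%N.
    by apply: leq_trans (size_polyMleq _ _) _; rewrite size_XsubC add2n /= ltnS.
  have : (size F <= (K * d).+1)%N.
    apply: leq_trans (size_poly_exp_leq _ _) _; by rewrite ltnS leq_mul // -subn1 leq_subLR.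
  have : (n * K.+1 <= N)%N by rewrite leq_mul2r nN0 orbT.
  have -> : (n * K.+1 = d * K + K + n)%N by rewrite /d; nia.
  by lia.
have phiF : dot (phi (toeplitz n F) *m v) w = c.
  have [r hr] := blaschke_trunc_mod a d nK.
  by rewrite (toeplitz_mod hr) vw nX.
have FT : \sum_(k < n) (F`_k)^* * dot (T k *m v) w = c.
  have FR : map_poly Num.conj F = F.
    rewrite /F /blaschke_trunc rmorphXn rmorphM rmorphB rmorph_sum /=.
    rewrite map_polyX map_polyC /= aR; congr ((_ * _) ^+ _); apply: eq_bigr => k _.
    by rewrite rmorphXn /= map_polyZ map_polyX /= aR.
  rewrite -phiF (linear_toeplitz phi_lin) mulmx_suml dot_suml; apply: eq_bigr => k _.
  by rewrite -scalemxAl dotZl -{2}FR coef_map.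
pose y (u : C) := (a * u) ^+ K.
have ynorm (u : C) : u * u^* = 1 -> `|y u| <= 2^-1 ^+ K.
  move=> u1; rewrite /y normrX normrM (norm_circle u1) mulr1 gtr0_norm //.
  by rewrite lerXn2r // nnegrE ?invr_ge0 ?ler0n // ltW.
have gF (u : C) : u * u^* = 1 -> (F.[u])^* = g u * ((1 - y u) ^+ d)^*.
  move=> u1; have := congr1 (fun f => (f.[u])^*) (blaschke_truncE a d K).
  rewrite !hornerM !rmorphM /= conj_pden // conj_pnum // -/F.
  have -> : ((1 - (a *: 'X) ^+ K) ^+ d).[u] = (1 - y u) ^+ d.
    by rewrite /y !(hornerE, horner_exp).
  have u0 : u^* ^+ d != 0.
    rewrite expf_neq0 // conjC_eq0; apply/negP => /eqP e0.
    by move/eqP: u1; rewrite e0 mul0r eq_sym oner_eq0.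
  have p0 := pnum_neq0 d a0 a12 u1.
  rewrite mulrCA -mulrA => /(mulfI u0) e; apply: (mulIf p0); rewrite e /g.
  by field.
(* [E] is the error in the cross term when [g] is replaced by the conjugate of the polynomial [F];
   it decays like [2^-K]. *)
pose E (u : C) := (g u - (F.[u])^*) * dot (symb phi u *m v) w.
have EB (u : C) : u * u^* = 1 -> `|E u| <= 2^-1 ^+ K * D * B.
  move=> u1; rewrite /E.
  have -> : g u - (F.[u])^* = g u * (1 - (1 - y u) ^+ d)^*.
    by rewrite gF // rmorphB /= conjC1; ring.
  have ng : `|g u| = 1 by apply/eqP; rewrite -sqrp_eq1 // normCK gg.
  rewrite 2!normrM ng mul1r norm_conjC; apply: ler_pM; rewrite ?symbB //.
  have y2 := ynorm u u1.
  apply: le_trans (norm_sub_exp _ _) _; last by rewrite ler_wpM2r.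
  by apply: le_trans y2 _; rewrite exprn_ile1 ?invr_ge0 ?ler0n // invf_le1 ?ltr0n // ler1n.
have hE u : u * u^* = 1 -> h u = dot (symb phi u *m v) v + dot (symb phi u *m w) w
   - ((F.[u])^* * dot (symb phi u *m v) w + ((F.[u])^* * dot (symb phi u *m v) w)^*) - (E u + (E u)^*).
  move=> u1; rewrite /h mulmxBr -scalemxAr !(dotDl, dotDr, dotNl, dotNr, dotZl, dotZr).
  have -> : dot (symb phi u *m w) v = (dot (symb phi u *m v) w)^*.
    by rewrite -dotC -dot_adjr adj_symb.
  rewrite mulrA gg // mul1r /E.
  move: (dot (symb phi u *m v) w) (g u) (F.[u]) => t gu fu.
  rewrite !(rmorphM, rmorphB) /= !conjCK; ring.
have sum1 (x : 'cV[C]_m) : dot x x = 1 -> \sum_(l < N) dot (symb phi (om ^+ l) *m x) x = N%:R.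
  move=> x1; have : (size (1 : {poly C})%R + n <= N)%N by rewrite size_poly1 /N; nia.
  move=> /(sum_symb x x omN).
  under eq_bigr => l _ do rewrite hornerC rmorph1 mul1r.
  move=> ->; rewrite (bigD1 (Ordinal n_gt0)) //= coef1 eqxx conjC1 mul1r phi_shift0 mul1mx x1.
  rewrite big1 ?addr0 ?mulr1 // => k k0; rewrite coef1.
  by rewrite (_ : (k == 0 :> nat)%N = false) ?rmorph0 ?mul0r //;
    apply/negbTE; apply: contra k0 => /eqP e; apply/eqP/val_inj.
(* The diagonal terms contribute [N] each and the cross terms [- 2 N c] with [c >= 1], so only the
   truncation error can make the sum positive. *)
have sumh : \sum_(l < N) h (om ^+ l) <= N%:R * (2 * (2^-1 ^+ K * D * B)).
  pose G (u : C) := (F.[u])^* * dot (symb phi u *m v) w.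
  have -> : \sum_(l < N) h (om ^+ l) =
      \sum_(l < N) dot (symb phi (om ^+ l) *m v) v
      + \sum_(l < N) dot (symb phi (om ^+ l) *m w) w
      - (\sum_(l < N) G (om ^+ l) + (\sum_(l < N) G (om ^+ l))^*)
      - (\sum_(l < N) E (om ^+ l) + \sum_(l < N) (E (om ^+ l))^*).
    rewrite rmorph_sum -!big_split -!sumrN -!big_split.
    by apply: eq_bigr => l _; rewrite hE.
  rewrite !sum1 // (sum_symb _ _ omN) // FT.
  have -> : (N%:R * c)^* = N%:R * c by rewrite rmorphM /= conjC_nat; congr (_ * _).
  have Ebound : - (\sum_(l < N) E (om ^+ l) + \sum_(l < N) (E (om ^+ l))^*) <=
      N%:R * (2 * (2^-1 ^+ K * D * B)).
    rewrite -big_split -sumrN mulr_natl -[X in _ *+ X](card_ord N) -sumr_const.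
    apply: ler_sum => l _ /=; have EE := EB _ (om1 l).
    apply: le_trans (_ : `|E (om ^+ l) + (E (om ^+ l))^*| <= _).
      rewrite -normrN real_ler_norm // realN CrealE rmorphD /= conjCK addrC //.
    by apply: le_trans (ler_normD _ _) _; rewrite norm_conjC mulr2n mulrDl !mul1r lerD.
  apply: le_trans Ebound; rewrite gerDr.
  rewrite -mulr2n -[X in _ - X]mulr2n -mulrnBl mulrn_wle0 //.
  by rewrite subr_le0 ler_peMr ?ler0n.
(* The summands are nonnegative and [z] is one of the nodes, so [h z] is at most the whole sum. *)
have hz : h z <= N%:R * (2 * (2^-1 ^+ K * D * B)).
  apply: le_trans sumh; rewrite (bigD1 l0) //= -zl0 lerDl sumr_ge0 // => l _.
  exact: h_ge0.
rewrite (le_trans (ler_wpM2l (ler0n _ _) hz)) //.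
have k2 : (2 : C) ^+ K != 0 by rewrite expf_neq0 // pnatr_eq0.
have -> : j.+1%:R * (N%:R * (2 * (2^-1 ^+ K * D * B))) =
    ((K.+1 * j.+1)%:R / 2 ^+ K) * (2 * N0%:R * D * B).
  by rewrite /N !natrM exprVn; field.
have -> : 4 * N0%:R * D * B = 2 * (2 * N0%:R * D * B) by ring.
rewrite ler_wpM2r ?mulr_ge0 ?ler0n // ler_pdivrMr ?exprn_gt0 ?ltr0n //.
by rewrite -natrX -natrM ler_nat geom_bound.
Qed.
End Isometry.
End SymbolKernel.

(** * Rigidity *)

Section Polynomials.
Variable C : numClosedFieldType.
Set Implicit Arguments. Unset Strict Implicit.

(** The powers of one primitive root of large order already outnumber the degree. Only orders
    [N >= n] are tested, as [symb_kernel] speaks of no others. *)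
Lemma poly_eq0_roots_unity (p : {poly C}) n :
  (forall N z, (n <= N)%N -> z ^+ N = 1 -> p.[z] = 0) -> p = 0.
Proof.
move=> h; pose N := (n + size p).+1.
have [w wN] := @prim_root_exists C N isT.
apply: (@roots_geq_poly_eq0 _ p [seq w ^+ l | l <- iota 0 N]).
- apply/allP=> z /mapP[l _ ->]; apply/rootP; apply: (h N); first by rewrite /N; lia.
  by rewrite exprAC (prim_expr_order wN) expr1n.
- rewrite map_inj_in_uniq ?iota_uniq // => i j; rewrite !mem_iota !add0n => /andP[_ iN] /andP[_ jN].
  by move/eqP; rewrite (eq_prim_root_expr wN) !modn_small // => /eqP.
- by rewrite size_map size_iota leqW ?leq_addl.
Qed.

(** Any [n] columns of the [n x (n + 1)] Vandermonde matrix of distinct nodes are independent, so a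
    relation that omits one column is trivial. *)
Lemma sum_power_rel n (a mu : 'I_n.+1 -> C) (k : 'I_n.+1) : injective a ->
  (forall l, (l < n)%N -> \sum_i mu i * a i ^+ l = 0) -> mu k = 0 -> forall i, mu i = 0.
Proof.
move=> ainj hmu muk i; have [->|ik] := eqVneq i k; first exact: muk.
have hpoly (g : {poly C}) : (size g <= n)%N -> \sum_i mu i * g.[a i] = 0.
  move=> sg; under eq_bigr => j _ do rewrite (horner_coef_wide _ sg) mulr_sumr.
  rewrite exchange_big big1 //= => l _.
  under eq_bigr => j _ do rewrite mulrCA.
  by rewrite -mulr_sumr hmu ?mulr0.
(* Test the relation against the polynomial vanishing at all nodes but [a i] and [a k]. *)
pose s := rem k (rem i (enum 'I_n.+1)).
have ui : uniq (rem i (enum 'I_n.+1)) by rewrite rem_uniq // enum_uniq.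
have ms j : (j \in s) = (j != k) && (j != i).
  by rewrite mem_rem_uniq // inE mem_rem_uniq ?enum_uniq // inE mem_enum andbT.
have sz : size s = n.-1.
  rewrite size_rem; last by rewrite mem_rem_uniq ?enum_uniq // inE mem_enum eq_sym ik.
  by rewrite size_rem ?mem_enum // size_enum_ord.
pose g : {poly C} := \prod_(j <- s) ('X - (a j)%:P).
have n0 : (0 < n)%N.
  by case: n a mu k i ik {ainj hmu muk hpoly s ui ms sz g} => // a mu k i; rewrite !ord1 eqxx.
have sg : (size g <= n)%N by rewrite size_prod_XsubC sz prednK.
have := hpoly g sg; rewrite (bigD1 i) //= big1 ?addr0 => [|j ji].
  move/eqP; rewrite mulf_eq0 => /orP[/eqP //|].
  rewrite /g horner_prod prodf_seq_eq0 => /hasP[j]; rewrite ms => /andP[_ ji] /=.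
  by rewrite !hornerE subr_eq0 (inj_eq ainj) eq_sym (negPf ji).
have [->|jk] := eqVneq j k; first by rewrite muk mul0r.
suff -> : g.[a j] = 0 by rewrite mulr0.
apply/eqP; rewrite /g horner_prod prodf_seq_eq0; apply/hasP; exists j; first by rewrite ms jk.
by rewrite !hornerE subrr.
Qed.

Lemma mulmx1_rev m n (A : 'M[C]_(m, n)) (B : 'M[C]_(n, m)) :
  B *m A = 1%:M -> (n <= m)%N /\ ((m <= n)%N -> A *m B = 1%:M).
Proof.
move=> BA; have nm : (n <= m)%N.
  by rewrite -(mxrank1 C n) -BA (leq_trans (mxrankM_maxl _ _)) // rank_leq_col.
split=> // mn; have e : m = n by apply/eqP; rewrite eqn_leq mn.
by case: n / e A B BA nm mn => A B BA _ _; apply: mulmx1C.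
Qed.

End Polynomials.

(** * The symbol as a polynomial, its divisors and its Gram coefficients *)

Section ToeplitzIsometry.
Variable R : realType.
Local Notation C := R[i].
Set Implicit Arguments. Unset Strict Implicit.

Variables (n m : nat) (n_gt0 : (0 < n)%N) (phi : 'M[C]_n -> 'M[C]_m).
Hypothesis phi_lin : linear_on (@inToeplitz R n) phi.
Hypothesis phi1 : phi 1%:M = 1%:M.
Hypothesis phi_iso : isometry_on (@inToeplitz R n) phi.
Local Notation T k := (phi (shift R n k)).
Local Notation d := n.-1.

(* [z^(n - 1) <symb z x, y>] as a polynomial in [z] *)
Definition symb_poly x y : {poly C} :=
  \sum_(k < n) dot (T k *m x) y *: 'X^(d + k)
  + \sum_(k < n) dot x (T k *m y) *: 'X^(d - k) - dot x y *: 'X^d.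

Lemma symb_polyE x y z : z * z^* = 1 ->
  (symb_poly x y).[z] = z ^+ d * dot (symb phi z *m x) y.
Proof.
move=> z1; rewrite dot_symb /symb_poly !hornerE !horner_sum mulrBr mulrDr.
congr (_ + _ - _); last by rewrite mulrC.
  by rewrite mulr_sumr; apply: eq_bigr => k _; rewrite hornerZ hornerXn exprD mulrC mulrA.
rewrite mulr_sumr; apply: eq_bigr => k _; rewrite hornerZ hornerXn.
have kd : (k <= d)%N by have := ltn_ord k; lia.
rewrite -{2}(subnK kd) exprD -mulrA [z ^+ k * _]mulrA -exprMn z1 expr1n mul1r.
by rewrite mulrC.
Qed.

Lemma size_symb_poly x y : (size (symb_poly x y) <= (d + d).+1)%N.
Proof.
have sX (c : C) k : (k <= d + d)%N -> (size (c *: 'X^k : {poly C}) <= (d + d).+1)%N.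
  by move=> h; apply: leq_trans (size_scale_leq _ _) _; rewrite size_polyXn ltnS.
apply: leq_trans (size_polyD _ _) _; rewrite geq_max size_polyN sX ?leq_addr // andbT.
apply: leq_trans (size_polyD _ _) _; rewrite geq_max.
apply/andP; split; apply: leq_trans (size_sum _ _ _) _; apply/bigmax_leqP => k _; apply: sX;
  have := ltn_ord k; lia.
Qed.

(** The powers [X^(d - j)] interfere only for [k = j = 0], where the subtracted [dot x y] cancels
    that contribution. *)
Lemma coef_symb_poly x y k : (k < n)%N -> (symb_poly x y)`_(d + k) = dot (T k *m x) y.
Proof.
move=> kn; rewrite /symb_poly coefB coefD !coef_sum coefZ coefXn.
rewrite (bigD1 (Ordinal kn)) //= coefZ coefXn eqxx mulr1 big1 ?addr0 => [|j ne]; last first.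
  rewrite coefZ coefXn eqn_add2l (_ : (k == j :> nat)%N = false) ?mulr0 //.
  by apply/negbTE; apply: contra ne => /eqP e; apply/eqP/val_inj.
rewrite (bigD1 (Ordinal n_gt0)) //= coefZ coefXn subn0 big1 ?addr0 => [|j ne]; last first.
  rewrite coefZ coefXn (_ : (d + k == d - j)%N = false) ?mulr0 //.
  by rewrite -val_eqE /= in ne; have := ltn_ord j; lia.
by rewrite (_ : T 0 *m y = y) ?addrK // (phi_shift0 phi1) mul1mx.
Qed.

Lemma symb_poly_suml I (r : seq I) (F : I -> 'cV[C]_m) (l : I -> C) y :
  symb_poly (\sum_(i <- r) l i *: F i) y = \sum_(i <- r) l i *: symb_poly (F i) y.
Proof.
elim: r => [|i r IH]; last first.
  rewrite !big_cons -IH; move: (\sum_(j <- r) _) => x.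
  rewrite /symb_poly !scalerBr !scalerDr !scaler_sumr dotDl dotZl.
  rewrite [RHS]addrACA [X in _ = X + _]addrACA -!big_split -opprD.
  congr (_ - _); last by rewrite scalerDl scalerA.
  apply: eq_bigr => k _ /=.
  by rewrite mulmxDr -scalemxAr !dotDl !dotZl !scalerDl !scalerA.
rewrite !big_nil /symb_poly dot0l scale0r subr0 !big1 ?addr0 // => k _.
  by rewrite dot0l scale0r.
by rewrite mulmx0 dot0l scale0r.
Qed.

Lemma coprimep_pnum_pden (a b : C) : a * b != 1 -> coprimep (pnum a d) (pden b d).
Proof.
move=> ab; apply: coprimep_expl; apply: coprimep_expr.
by rewrite coprimep_sym coprimep_XsubC rootE !hornerE subr_eq0 eq_sym mulrC.
Qed.

(** With [p = pnum] and [q = pden], [symb_kernel] gives [q P v = p P w] at roots of unity, hence an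
    identity of polynomials, and coprimality yields the first divisibility. The second follows from
    self-adjointness of the symbol, since conjugation exchanges [p] and [q]. *)
Lemma symb_poly_dvd (a : C) : 0 < a -> a <= 2^-1 -> exists2 v : 'cV[C]_m, dot v v = 1 &
  forall y, pnum a d %| symb_poly v y /\ pden a d %| symb_poly y v.
Proof.
move=> a0 a12; have [v [w [v1 key]]] := symb_kernel n_gt0 phi_lin phi1 phi_iso a0 a12.
have aR : a^* = a by apply/CrealP; rewrite ger0_real // ltW.
exists v => // y.
have aa : a * a != 1.
  rewrite lt_eqF // (le_lt_trans (ler_pM (ltW a0) (ltW a0) a12 a12)) //.
  by rewrite -expr2 exprVn invf_lt1 ?exprn_gt0 ?ltr0n // -natrX ltr1n.
have cop := coprimep_pnum_pden aa.
have e1 : pden a d * symb_poly v y = pnum a d * symb_poly w y.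
  apply/eqP; rewrite -subr_eq0; apply/eqP; apply: (@poly_eq0_roots_unity _ _ n) => N z nN zN.
  have z1 : z * z^* = 1 by apply: (@unit_root_conj _ N) => //; lia.
  have := congr1 (fun x => dot x y) (key N z nN zN).
  rewrite dot0l mulmxBr -!scalemxAr dotDl dotNl !dotZl => /eqP; rewrite subr_eq0 => /eqP e.
  rewrite hornerD hornerN hornerM [X in _ - X]hornerM !symb_polyE //.
  by rewrite mulrCA e mulrCA subrr.
have e2 : pden a d * symb_poly y w = pnum a d * symb_poly y v.
  apply/eqP; rewrite -subr_eq0; apply/eqP; apply: (@poly_eq0_roots_unity _ _ n) => N z nN zN.
  have z1 : z * z^* = 1 by apply: (@unit_root_conj _ N) => //; lia.
  have zd : z^* ^+ d != 0.
    rewrite expf_neq0 // conjC_eq0; apply/negP => /eqP e0.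
    by move/eqP: z1; rewrite e0 mul0r eq_sym oner_eq0.
  have := congr1 (fun x => dot y x) (key N z nN zN).
  rewrite dot0r -dot_adjr adj_symb dotDr dotNr !dotZr conj_pden // conj_pnum //.
  rewrite -!mulrA -mulrBr => /eqP; rewrite mulf_eq0 (negPf zd) subr_eq0 /= => /eqP e.
  rewrite hornerD hornerN hornerM [X in _ - X]hornerM !symb_polyE //.
  by rewrite mulrCA -e mulrCA subrr.
have cop' : coprimep (pden a d) (pnum a d) by rewrite coprimep_sym.
by rewrite -(Gauss_dvdpr _ cop) e1 -(Gauss_dvdpr _ cop') -e2 !dvdp_mulIl.
Qed.


(** The product of the two coprime divisors already has the maximal degree [2 d], [b != 0] giving
    [pden b d] its full degree, so the quotient is constant. *)
Lemma symb_poly_factor (a b : C) v w : a * b != 1 -> b != 0 ->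
  pnum a d %| symb_poly v w -> pden b d %| symb_poly v w ->
  exists c : C, symb_poly v w = c *: (pnum a d * pden b d).
Proof.
move=> ab b0 h1 h2.
have cop := coprimep_pnum_pden ab.
have : pnum a d * pden b d %| symb_poly v w by rewrite Gauss_dvdp // h1 h2.
case/dvdpP => q hq.
have sp : size (pnum a d) = d.+1 by rewrite /pnum size_exp_XsubC.
have p0 : pnum a d != 0 by rewrite -size_poly_gt0 sp.
have sl : size (1 - b *: 'X : {poly C}) = 2%N.
  rewrite addrC size_polyDl size_polyN size_scale ?size_polyX ?size_poly1 //.
have q0 : pden b d != 0 := pden_neq0 b d.
have sq : size (pden b d) = d.+1.
  by rewrite -[LHS]prednK ?size_poly_gt0 // size_exp sl mul1n.
exists q`_0; rewrite {1}hq -mul_polyC; congr (_ * _).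
have [->|qn0] := eqVneq q 0; first by rewrite coef0.
apply: size1_polyC.
have := size_symb_poly v w; rewrite hq size_mul ?mulf_neq0 // size_mul // sp sq.
by move: (size q) d => s e; clear; lia.
Qed.

(** Distinct reals in [(0, 1/2]], the range that [symb_kernel] accepts. *)
Local Notation a_ i := ((i.+2%:R)^-1 : C).

Lemma node_gt0 i : 0 < a_ i. Proof. by rewrite invr_gt0 ltr0n. Qed.
Lemma node_le i : a_ i <= 2^-1. Proof. by rewrite lef_pV2 ?posrE ?ltr0n // ler_nat. Qed.
Lemma node_real i : (a_ i)^* = a_ i. Proof. by rewrite fmorphV /= conjC_nat. Qed.
Lemma node_mul i j : a_ i * a_ j != 1.
Proof.
rewrite lt_eqF //; apply: le_lt_trans (_ : 2^-1 * 2^-1 < _).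
  by apply: ler_pM; rewrite ?node_le // ltW ?node_gt0.
by rewrite -expr2 exprVn invf_lt1 ?exprn_gt0 ?ltr0n // -natrX ltr1n.
Qed.
Lemma node_inj i j : a_ i = a_ j -> i = j.
Proof. by move/invr_inj/eqP; rewrite eqr_nat => /eqP[]. Qed.

(** The coefficient of [X^(d - l)] in [pnum a d] is [(- a)^l] times a nonzero binomial, so such a
    relation is one between powers of the nodes. *)
Lemma pnum_rel (mu : 'I_n.+1 -> C) k : \sum_i mu i *: pnum (a_ i) d = 0 ->
  mu k = 0 -> forall i, mu i = 0.
Proof.
move=> h; apply: (@sum_power_rel _ n (fun i => - a_ (i : nat))).
  by move=> i j /oppr_inj /node_inj e; apply: val_inj.
move=> l ln.
have ld : (l <= d)%N by lia.
have := congr1 (fun f : {poly C} => f`_(d - l)) h; rewrite coef0 coef_sum.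
under eq_bigr => i _ do rewrite coefZ pnum_coef ?leq_subr // subKn // mulrnAr.
rewrite sumrMnl => /eqP; rewrite mulrn_eq0 (_ : 'C(_, _) == 0 = false)%N ?orFb => [/eqP //|].
by rewrite bin_sub // -leqn0 leqNgt bin_gt0 ld.
Qed.

Lemma gram_points : exists (v : 'I_n.+1 -> 'cV[C]_m) (c : 'I_n.+1 -> 'I_n.+1 -> C),
  [/\ forall i j, symb_poly (v i) (v j) = c i j *: (pnum (a_ i) d * pden (a_ j) d),
      forall i j, c j i = (c i j)^* & forall i, 0 < c i i].
Proof.
have /fin_all_exists[v hv] : forall i : 'I_n.+1, exists v : 'cV[C]_m, dot v v = 1 /\
    forall y, pnum (a_ i) d %| symb_poly v y /\ pden (a_ i) d %| symb_poly y v.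
  by move=> i; have [v v1 h] := symb_poly_dvd (node_gt0 i) (node_le i); exists v.
have /fin_all_exists[c hc] : forall ij : 'I_n.+1 * 'I_n.+1, exists c : C,
    symb_poly (v ij.1) (v ij.2) = c *: (pnum (a_ ij.1) d * pden (a_ ij.2) d).
  move=> [i j] /=; apply: symb_poly_factor; first exact: node_mul.
  - by rewrite gt_eqF ?node_gt0.
  - by have [_ /(_ (v j))[]] := hv i.
  - by have [_ /(_ (v i))[]] := hv j.
exists v, (fun i j => c (i, j)).
(* At [z = 1] both [pnum] and [pden] take this positive value, so the symmetry and positivity of
   [symb phi 1] pass to [c]. *)
pose b i := (1 - a_ i) ^+ d.
have b0 i : 0 < b i.
  apply: exprn_gt0; rewrite subr_gt0 (le_lt_trans (node_le i)) //.
  by rewrite invf_lt1 ?ltr0n // ltr1n.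
have bR i : (b i)^* = b i by rewrite rmorphXn rmorphB /= conjC1 node_real.
have one1 : 1 * 1^* = 1 :> C by rewrite conjC1 mulr1.
have ev (i j : 'I_n.+1) : dot (symb phi 1 *m v i) (v j) = c (i, j) * (b i * b j).
  have := congr1 (fun f => f.[1]) (hc (i, j)).
  by rewrite /= symb_polyE // expr1n mul1r hornerZ hornerM pnumE pdenE mulr1.
split=> [i j|i j|i]; first exact: hc (i, j).
  have bb : b i * b j != 0 by rewrite mulf_neq0 // gt_eqF.
  have : dot (symb phi 1 *m v j) (v i) = (dot (symb phi 1 *m v i) (v j))^*.
    by rewrite -dotC -dot_adjr adj_symb.
  rewrite !ev rmorphM [X in _ = _ * X]rmorphM /= !bR [b j * b i]mulrC.
  by move/(mulIf bb).
rewrite lt_def; apply/andP; split.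
  apply/eqP => c0; have := hc (i, i); rewrite /= c0 scale0r => h.
  have := coef_symb_poly (v i) (v i) n_gt0; rewrite h coef0 (phi_shift0 phi1) mul1mx.
  by have [-> _] := hv i => /eqP; rewrite eq_sym oner_eq0.
have := symb_psd n_gt0 phi_lin phi1 phi_iso one1 (v i).
by rewrite ev pmulr_lge0 // mulr_gt0.
Qed.

End ToeplitzIsometry.

(** * Rank one Gram coefficients and unitary conjugation *)

Section Rigidity.
Variable R : realType.
Local Notation C := R[i].
Set Implicit Arguments. Unset Strict Implicit.

Variables (n m : nat) (n_gt0 : (0 < n)%N) (phi : 'M[C]_n -> 'M[C]_m).
Hypothesis phi_lin : linear_on (@inToeplitz R n) phi.
Hypothesis phi1 : phi 1%:M = 1%:M.
Hypothesis phi_iso : isometry_on (@inToeplitz R n) phi.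
Local Notation T k := (phi (shift R n k)).
Local Notation d := n.-1.
Local Notation a_ i := ((i.+2%:R)^-1 : C).

Lemma gram_rank1 : (m <= n)%N -> exists v : 'I_n.+1 -> 'cV[C]_m,
  forall i j, symb_poly phi (v i) (v j) = pnum (a_ i) d * pden (a_ j) d.
Proof.
move=> mn; have [v [c [hc cC c0]]] := gram_points n_gt0 phi_lin phi1 phi_iso.
(* The [n + 1] vectors [v i] are dependent in dimension [m <= n]; [la] will hold the coefficients of
   a relation. *)
pose M : 'M[C]_(n.+1, m) := \matrix_(i, l) v i l 0.
have : kermx M != 0.
  by rewrite kermx_eq0 /row_free neq_ltn ltnS (leq_trans (rank_leq_col M) mn).
case/rowV0Pn => la /sub_kermxP laM la0.
have lav : \sum_i la 0 i *: v i = 0.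
  apply/matrixP=> l j; rewrite ord1 summxE [RHS]mxE.
  have := congr1 (fun A : 'rV_m => A 0 l) laM; rewrite !mxE => h; rewrite -[RHS]h.
  by apply: eq_bigr => i _; rewrite !mxE.
have rel j : \sum_i (la 0 i * c i j) *: pnum (a_ i) d = 0.
  apply: (mulIf (pden_neq0 (a_ j) d)); rewrite mul0r mulr_suml.
  have := symb_poly_suml phi (index_enum _) v (la 0) (v j); rewrite lav.
  have -> : symb_poly phi 0 (v j) = 0.
    rewrite /symb_poly dot0l scale0r subr0 !big1 ?addr0 // => k _; first by rewrite dot0l scale0r.
    by rewrite mulmx0 dot0l scale0r.
  by move=> h; rewrite [RHS]h; apply: eq_bigr => i _; rewrite hc -scalerAl scalerA.
have [k lak] : exists k, la 0 k != 0.
  by case/rV0Pn: la0 => k; exists k.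
have ck0 : c k k != 0 by rewrite gt_eqF.
(* A zero coefficient would make the relation [rel k] trivial, but its coefficient at [k] is
   nonzero. *)
have mu0 i : la 0 i * c i k != 0.
  apply/eqP => h; have := pnum_rel n_gt0 (rel k) h k => /eqP.
  by rewrite mulf_eq0 (negPf lak) (negPf ck0).
have la_neq0 i : la 0 i != 0 by have := mu0 i; rewrite mulf_eq0 negb_or => /andP[].
have ci0 i : c i k != 0 by have := mu0 i; rewrite mulf_eq0 negb_or => /andP[].
have rank1 i j : c k k * c i j = c i k * c k j.
  (* This combination of the relations for [j] and [k] vanishes at index [k], hence everywhere. *)
  pose nu i := la 0 k * c k k * (la 0 i * c i j) - la 0 k * c k j * (la 0 i * c i k).
  have nu0 : \sum_i nu i *: pnum (a_ i) d = 0.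
    under eq_bigr => l _ do
      rewrite scalerBl -[(_ * (la 0 l * c l j)) *: _]scalerA -[(_ * (la 0 l * c l k)) *: _]scalerA.
    by rewrite sumrB -!scaler_sumr !rel !scaler0 subrr.
  have nuk : nu k = 0 by rewrite /nu; ring.
  have := pnum_rel n_gt0 nu0 nuk i; rewrite /nu => h.
  have l2 : la 0 k * la 0 i != 0 by rewrite mulf_neq0.
  apply: (mulfI l2); apply/eqP; rewrite -subr_eq0 -h; apply/eqP; ring.
pose s := sqrtC (c k k).
have ss : s * s = c k k by rewrite -expr2 sqrtCK.
have s_gt0 : 0 < s by rewrite sqrtC_gt0.
have sR : s^* = s by apply/CrealP; rewrite ger0_real // ltW.
have s0 : s != 0 by rewrite gt_eqF.
(* The rescaling turns the rank one hermitian matrix [c] into the all-ones matrix. *)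
exists (fun i => (s / c i k) *: v i) => i j.
have pull (x y : C) : symb_poly phi (x *: v i) (y *: v j) = (x * y^*) *: symb_poly phi (v i) (v j).
  rewrite /symb_poly !scalerBr !scalerDr !scaler_sumr.
  congr (_ + _ - _); last by rewrite dotZl dotZr scalerA mulrA.
    by apply: eq_bigr => l _; rewrite -scalemxAr dotZl dotZr scalerA mulrA.
  by apply: eq_bigr => l _; rewrite -scalemxAr dotZl dotZr scalerA mulrA.
rewrite pull hc scalerA rmorphM fmorphV /= sR -(cC j k).
suff -> : s / c i k * (s / c k j) * c i j = 1 by rewrite scale1r.
have ckj : c k j != 0 by rewrite (cC j k) conjC_eq0.
have -> : s / c i k * (s / c k j) * c i j = (s * s * c i j) / (c i k * c k j) by field; rewrite ckj ci0.
by rewrite ss rank1 divff // mulf_neq0.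
Qed.

(** As [pden b d] is the reversal of [pnum b d], this coefficient is the correlation of two
    coefficient vectors at lag [k]; the conjugation in [dot] is harmless for real [b]. *)
Lemma coef_pnum_pden k (a b : C) : b^* = b -> (k < n)%N ->
  (pnum a d * pden b d)`_(d + k) =
  dot (shift R n k *m (\col_l (pnum a d)`_l)) (\col_l (pnum b d)`_l).
Proof.
move=> bR kn; rewrite coefM -(big_mkord xpredT (fun u => (pnum a d)`_u * (pden b d)`_(d + k - u))).
rewrite (big_cat_nat (n := k)) //=; last by lia.
have den0 u : (d < u)%N -> (pden b d)`_u = 0.
  move=> du; rewrite nth_default // (leq_trans _ du) //.
  apply: leq_trans (size_poly_exp_leq _ _) _; rewrite ltnS -[leqRHS]mul1n leq_mul // -subn1 leq_subLR.
  apply: leq_trans (size_polyD _ _) _; rewrite geq_max size_poly1 size_polyN /=.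
  by apply: leq_trans (size_scale_leq _ _) _; rewrite size_polyX.
have num0 u : (d < u)%N -> (pnum a d)`_u = 0.
  by move=> du; rewrite nth_default // size_exp_XsubC.
rewrite big1_seq ?add0r; last first.
  by move=> u; rewrite mem_index_iota => /andP[_ /andP[_ uk]]; rewrite [X in _ * X]den0 ?mulr0 //; lia.
rewrite -{1}[k]add0n big_addn (_ : ((d + k).+1 - k = n)%N); last by lia.
rewrite big_mkord dotE; apply: eq_bigr => l _.
have ln := ltn_ord l; have ld : (l <= d)%N by lia.
have -> : (pden b d)`_(d + k - (l + k)) = ((\col_l0 (pnum b d)`_l0 : 'cV[C]_n) l 0)^*.
  rewrite mxE subnDr -pnum_rev ?leq_subr // subKn // pnum_coef //.
  by rewrite rmorphMn rmorphXn rmorphN /= bR.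
congr (_ * _); rewrite mxE.
have [lk|lk] := ltnP (l + k) n.
  rewrite (bigD1 (Ordinal lk)) //= shiftE eqxx mul1r mxE big1 ?addr0 // => u ne.
  rewrite shiftE (_ : (u == l + k :> nat)%N = false) ?mul0r //.
  by apply/negbTE; apply: contra ne => /eqP e; apply/eqP/val_inj.
rewrite num0; last by lia.
rewrite big1 // => u _; rewrite shiftE (_ : (u == l + k :> nat)%N = false) ?mul0r //.
by have := ltn_ord u; lia.
Qed.

(** A row [r] in the left kernel yields a polynomial of degree at most [d], with coefficients [r_l]
    times nonzero binomials, that vanishes at the [n + 1] points [- a_i]. *)
Lemma pnum_row_free : row_free (\matrix_(l < n, i < n.+1) (pnum (a_ i) d)`_l).
Proof.
set B := \matrix_(l, i) _; rewrite -kermx_eq0; apply/rowV0Pn => -[r /sub_kermxP rB r0].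
case/negP: r0; apply/eqP/rowP => l0; rewrite [RHS]mxE.
pose g : {poly C} := \sum_(l < n) (r 0 l * 'C(d, l)%:R) *: 'X^(d - l).
have gco (l : 'I_n) : g`_(d - l) = r 0 l * 'C(d, l)%:R.
  rewrite coef_sum (bigD1 l) //= coefZ coefXn eqxx mulr1 big1 ?addr0 // => u ne.
  rewrite coefZ coefXn (_ : (d - l == d - u)%N = false) ?mulr0 //.
  by rewrite -val_eqE /= in ne; have := ltn_ord u; have := ltn_ord l; lia.
have g0 : g = 0.
  apply: (@roots_geq_poly_eq0 _ g [seq - a_ i | i <- iota 0 n.+1]).
  - apply/allP=> z hz; have [i hi ->] := mapP hz; move: hi; rewrite mem_iota add0n => /andP[_ ilt].
    apply/rootP.
    have := congr1 (fun A : 'rV_n.+1 => A 0 (Ordinal ilt)) rB; rewrite !mxE => h; rewrite -[RHS]h.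
    rewrite horner_sum; apply: eq_bigr => l _; rewrite !mxE hornerZ hornerXn.
    have ld : (l <= d)%N by have := ltn_ord l; lia.
    by rewrite pnum_coef //= -mulrA mulr_natl.
  - by rewrite map_inj_in_uniq ?iota_uniq // => i j _ _ /oppr_inj /node_inj.
  - rewrite size_map size_iota; apply: leq_trans (size_sum _ _ _) _; apply/bigmax_leqP => l _.
    by apply: leq_trans (size_scale_leq _ _) _; rewrite size_polyXn; lia.
have := gco l0; rewrite g0 coef0 => /esym/eqP; rewrite mulf_eq0 pnatr_eq0 => /orP[/eqP //|].
by rewrite -leqn0 leqNgt bin_gt0; have := ltn_ord l0; lia.
Qed.

Theorem toeplitz_isometry_rigid : (m <= n)%N -> exists V : 'M[C]_(m, n),
  [/\ adj V *m V = 1%:M, V *m adj V = 1%:M &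
      forall X, inToeplitz X -> phi X = V *m X *m adj V].
Proof.
move=> mn; have [v hv] := gram_rank1 mn.
pose B : 'M[C]_(n, n.+1) := \matrix_(l < n, i < n.+1) (pnum (a_ i) d)`_l.
pose W : 'M[C]_(m, n.+1) := \matrix_(l, i) v i l 0.
have WT k : (k < n)%N -> adj W *m T k *m W = adj B *m shift R n k *m B.
  move=> kn; apply/matrixP=> j i.
  have entry p (A : 'M[C]_(p, n.+1)) (Z : 'M_p) :
     (adj A *m Z *m A) j i = dot (Z *m col i A) (col j A).
    rewrite -mulmxA /dot !mxE; apply: eq_bigr => l _; rewrite !mxE; congr (_ * _).
    by apply: eq_bigr => s _; rewrite !mxE.
  rewrite !entry.
  have -> : col i W = v i by apply/colP=> s; rewrite !mxE.
  have -> : col j W = v j by apply/colP=> s; rewrite !mxE.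
  have -> : col i B = \col_l (pnum (a_ i) d)`_l by apply/colP=> s; rewrite !mxE.
  have -> : col j B = \col_l (pnum (a_ j) d)`_l by apply/colP=> s; rewrite !mxE.
  rewrite -(coef_symb_poly n_gt0 phi1 _ _ kn) hv coef_pnum_pden //; exact: node_real.
(* A right inverse of [B] turns the Gram identities into [V^* T_k V = S^k]; [k = 0] makes [V] an
   isometry, and [m <= n] makes it unitary. *)
have [P BK] : exists P, B *m P = 1%:M.
  by exists (pinvmx B); apply: mulmxVp; apply: pnum_row_free.
pose V := W *m P.
have VT k : (k < n)%N -> adj V *m T k *m V = shift R n k.
  move=> kn; have -> : adj V *m T k *m V = adj P *m (adj W *m T k *m W) *m P.
    by rewrite /V adjM !mulmxA.
  by rewrite WT // !mulmxA -adjM BK adj1mx mul1mx -mulmxA BK mulmx1.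
move: V VT => V VT.
have VV : adj V *m V = 1%:M.
  by have := VT 0 n_gt0; rewrite (phi_shift0 phi1) mulmx1.
have [_ /(_ mn) VV'] := mulmx1_rev VV.
exists V; split=> // X [f ->].
have TV (k : 'I_n) : T k = V *m shift R n k *m adj V.
  by rewrite -[X in _ = V *m X *m _]VT // !mulmxA VV' mul1mx -mulmxA VV' mulmx1.
rewrite -/(toeplitz n f) (linear_toeplitz phi_lin) toeplitz_truncE.
rewrite mulmx_sumr mulmx_suml; apply: eq_bigr => k _.
by rewrite -scalemxAr -scalemxAl -TV.
Qed.

(** For [m < n] rigidity would provide an isometry from [C^n] into [C^m]. *)
Lemma toeplitz_isometry_dim : (n <= m)%N.
Proof.
case: (leqP n m) => // mn.
have [V [/mulmx1_rev[nm _] _ _]] := toeplitz_isometry_rigid (ltnW mn).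
by move: nm; rewrite leqNgt mn.
Qed.

End Rigidity.

(** * The C*-envelope *)

Section StarHomomorphism.
Variable R : realType.
Local Notation C := R[i].
Set Implicit Arguments. Unset Strict Implicit.

Lemma mulmx_col p q r (A : 'M[C]_(p, q)) (B : 'M[C]_(q, r)) j : A *m col j B = col j (A *m B).
Proof. by rewrite !colE mulmxA. Qed.

Section Homomorphism.
Variables (n m : nat) (T : 'M[C]_m -> Prop) (pi : 'M[C]_m -> 'M[C]_n).
Hypothesis pi_hom : surj_star_hom_on (cstar_gen T) pi.
Local Notation D := (cstar_gen T).

Lemma cstar_gen0 : D 0.
Proof. by rewrite -(scale0r 1%:M); apply/cg_scale/cg_one. Qed.

Lemma cstar_genB X Y : D X -> D Y -> D (X - Y).
Proof. by move=> DX DY; rewrite -scaleN1r; apply: cg_add => //; apply: cg_scale. Qed.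

Lemma star_hom0 : pi 0 = 0.
Proof.
have [lin _ _ _ _] := pi_hom; have := lin 1 0 0 cstar_gen0 cstar_gen0.
by rewrite !scale1r addr0 => /(congr1 (fun X => X - pi 0)); rewrite addrK subrr.
Qed.

Lemma star_homD X Y : D X -> D Y -> pi (X + Y) = pi X + pi Y.
Proof. by have [lin _ _ _ _] := pi_hom => DX DY; have := lin 1 X Y DX DY; rewrite !scale1r. Qed.

Lemma star_homZ a X : D X -> pi (a *: X) = a *: pi X.
Proof.
have [lin _ _ _ _] := pi_hom => DX; have := lin a X 0 DX cstar_gen0.
by rewrite star_hom0 !addr0.
Qed.

Lemma star_homB X Y : D X -> D Y -> pi (X - Y) = pi X - pi Y.
Proof.
move=> DX DY; rewrite -scaleN1r star_homD //; last exact: cg_scale.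
by rewrite star_homZ // scaleN1r.
Qed.

Lemma star_hom_sum I (r : seq I) (F : I -> 'M[C]_m) : (forall i, D (F i)) ->
  D (\sum_(i <- r) F i) /\ pi (\sum_(i <- r) F i) = \sum_(i <- r) pi (F i).
Proof.
move=> DF; elim: r => [|i r [IH1 IH2]]; first by rewrite !big_nil; split;
  [apply: cstar_gen0 | apply: star_hom0].
by rewrite !big_cons star_homD // IH2; split=> //; apply: cg_add.
Qed.

End Homomorphism.

Section Compression.
Variables (n m : nat) (n_gt0 : (0 < n)%N) (T : 'M[C]_m -> Prop) (pi : 'M[C]_m -> 'M[C]_n).
Hypothesis pi_hom : surj_star_hom_on (cstar_gen T) pi.
Local Notation D := (cstar_gen T).

(* A homomorphism killing [h] maps [char_poly h] evaluated at [h], which is zero, to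
   the scalar [det h] up to sign. *)
Lemma star_hom_ker_singular h : D h -> pi h = 0 -> \det h = 0.
Proof.
have [_ mult _ pi1 _] := pi_hom.
case: m T pi pi_hom mult pi1 h => [|m'] T' pi' hom' mult pi1 h Dh ph.
  have p0 : pi' 1%:M = 0.
    by rewrite (_ : 1%:M = h) //; apply/matrixP => -[].
  have := congr1 (fun A : 'M_n => A (Ordinal n_gt0) (Ordinal n_gt0)) p0.
  by rewrite pi1 !mxE eqxx => /eqP; rewrite oner_eq0.
have horner q : cstar_gen T' (horner_mx h q) /\ pi' (horner_mx h q) = q`_0 *: 1%:M.
  elim/poly_ind: q => [|q c [IH1 IH2]]; first by rewrite rmorph0 coef0 scale0r; split;
    [apply: cstar_gen0 | apply: star_hom0 hom'].
  rewrite rmorphD rmorphM /= horner_mx_X horner_mx_C coefD coefMX coefC /= add0r.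
  have Dq : cstar_gen T' (horner_mx h q *m h) by apply: cg_mul.
  have Dc : cstar_gen T' (c *: 1%:M) by apply/cg_scale/cg_one.
  rewrite -mulmxE -[c%:M]scalemx1; split; first exact: (cg_add Dq Dc).
  rewrite (star_homD hom') // mult // ph mulmx0 add0r (star_homZ hom') ?pi1 //.
  exact: cg_one.
have [_] := horner (char_poly h); rewrite Cayley_Hamilton (star_hom0 hom') char_poly_det.
move=> /(congr1 (fun A : 'M_n => A (Ordinal n_gt0) (Ordinal n_gt0))).
rewrite !mxE eqxx mulr1 => /esym/eqP; rewrite mulf_eq0 => /orP[|/eqP //].
by rewrite expf_eq0 oppr_eq0 oner_eq0 andbF.
Qed.

Lemma star_hom_ker_vector : exists2 v : 'cV[C]_m, v != 0 &
  forall X, D X -> pi X = 0 -> X *m v = 0.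
Proof.
have [_ mult star _ _] := pi_hom.
pose P k := `[< exists h, [/\ D h, pi h = 0, psd h & \rank h = k] >].
have exP : exists k, P k.
  exists 0%N; apply/asboolP; exists 0; split; rewrite ?mxrank0 //.
  - exact: cstar_gen0.
  - exact: (star_hom0 pi_hom).
  - by move=> x; rewrite mul0mx dot0l.
have Pm k : P k -> (k <= m)%N.
  by move=> /asboolP[h [_ _ _ <-]]; apply: rank_leq_row.
(* Adding [X^* X] cannot increase the rank of [h], so [X] kills the null space of [h]. *)
case: (ex_maxnP exP Pm) => k /asboolP[h [Dh ph hpsd rk]] kmax.
have /eqP/det0P[u u0 uh] : \det h^T = 0 by rewrite det_tr; apply: star_hom_ker_singular.
exists u^T; first by rewrite trmx_eq0.
move=> X DX pX; pose h' := h + adj X *m X.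
have Da : D (adj X *m X) by apply: cg_mul => //; apply: cg_adj.
have pa : pi (adj X *m X) = 0 by rewrite mult ?pX ?mulmx0 //; apply: cg_adj.
have dotX x : dot (adj X *m X *m x) x = dot (X *m x) (X *m x).
  by rewrite -mulmxA dot_adjr.
have kerX p (x : 'M[C]_(m, p)) : h' *m x = 0 -> X *m x = 0 /\ h *m x = 0.
  move=> hx; suff Xx : X *m x = 0.
    by split=> //; move: hx; rewrite mulmxDl -mulmxA Xx mulmx0 addr0.
  apply/matrixP=> i j; rewrite [RHS]mxE.
  have : h' *m col j x = 0 by rewrite mulmx_col hx; apply/colP=> k'; rewrite !mxE.
  move=> /(congr1 (fun y => dot y (col j x))); rewrite dot0l mulmxDl dotDl dotX => /eqP.
  rewrite paddr_eq0 ?dot_ge0 // => /andP[_ /eqP/dot_eq0].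
  by rewrite mulmx_col => /colP/(_ i); rewrite !mxE.
(* The null space of [h'] lies in that of [h], so the row space of [h] lies in that of [h'];
   maximality of the rank makes them equal. *)
have sub : (h <= h')%MS.
  by rewrite submxE; have [_ ->] := kerX _ _ (mulmx_coker h').
have rk' : (\rank h' <= \rank h)%N.
  rewrite rk; apply: kmax; apply/asboolP; exists h'; split=> //.
  - exact: cg_add.
  - by rewrite (star_homD pi_hom) // ph pa addr0.
  - by move=> x; rewrite mulmxDl dotDl addr_ge0 // dotX dot_ge0.
have : (h' <= h)%MS by rewrite -(mxrank_leqif_sup sub) eqn_leq mxrankS.
case/submxP => A hA; have hu : h' *m u^T = 0.
  by rewrite hA -mulmxA (_ : h *m u^T = 0) ?mulmx0 // -[h]trmxK -trmx_mul uh trmx0.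
by have [] := kerX _ _ hu.
Qed.

(** On a vector killed by the kernel of [pi] the algebra acts through [pi], that is as [M_n]. Lifted
    matrix units carry a unit vector fixed by the lift of [E o o] to the orthonormal columns of
    [W]. *)
Lemma star_hom_compression : exists2 W : 'M[C]_(m, n), adj W *m W = 1%:M &
  forall Y, D Y -> Y *m W = W *m pi Y.
Proof.
have [_ mult star pi1 surj] := pi_hom.
have /choice[L hL] : forall Z, exists X, D X /\ pi X = Z.
  by move=> Z; have [X DX pX] := surj Z; exists X.
have DL Z : D (L Z) by have [] := hL Z.
have pL Z : pi (L Z) = Z by have [] := hL Z.
have [v v0 hv] := star_hom_ker_vector.
pose o := Ordinal n_gt0; pose E i j : 'M[C]_n := delta_mx i j.
have EE i j k l : E i j *m E k l = (j == k)%:R *: E i l.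
  by rewrite mul_delta_mx_cond; case: eqP => _; rewrite ?mulr1n ?scale1r ?mulr0n ?scale0r.
(* Otherwise [v] would vanish, because [1] and the sum of the [L (E i o) *m L (E o i)] have the same
   image under [pi]. *)
have [i w0] : exists i, L (E o i) *m v != 0.
  apply/not_existsP => h; case/eqP: v0.
  have Dj i : D (L (E i o) *m L (E o i)) by apply: cg_mul.
  have [DS pS] := star_hom_sum pi_hom (index_enum 'I_n) Dj.
  have p0 : pi (1%:M - \sum_i L (E i o) *m L (E o i)) = 0.
    rewrite (star_homB pi_hom) ?pi1 ?pS //; last exact: cg_one.
    rewrite (eq_bigr (fun i => E i i)) => [|i _]; last by rewrite mult // !pL EE eqxx scale1r.
    by rewrite -mx1_sum_delta subrr.
  have := hv _ (cstar_genB (cg_one _) DS) p0.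
  rewrite mulmxBl mul1mx mulmx_suml big1 ?subr0 // => i _; rewrite -mulmxA.
  by have /negP/negPn/eqP -> := h i; rewrite mulmx0.
pose s := (sqrtC (dot (L (E o i) *m v) (L (E o i) *m v)))^-1.
pose w := s *: (L (E o i) *m v).
have w1 : dot w w = 1.
  rewrite dotZl dotZr; set r := dot _ _.
  have r0 : 0 < r by apply: dot_gt0.
  have sR : s^* = s by apply/CrealP; rewrite ger0_real // invr_ge0 sqrtC_ge0 ltW.
  by rewrite sR mulrA -invfM -expr2 sqrtCK mulVf // gt_eqF.
have eqw X Y : D X -> D Y -> pi X = pi Y -> X *m w = Y *m w.
  move=> DX DY e; apply/eqP; rewrite -subr_eq0 -mulmxBl -scalemxAr mulmxA.
  rewrite hv ?scaler0 //; first by apply: cg_mul => //; apply: cstar_genB.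
  by rewrite mult ?(star_homB pi_hom) // ?e ?subrr ?mul0mx //; apply: cstar_genB.
have Lw : L (E o o) *m w = w.
  rewrite /w -scalemxAr mulmxA; congr (_ *: _); apply/eqP; rewrite -subr_eq0 -mulmxBl.
  have D2 : D (L (E o o) *m L (E o i)) by apply: cg_mul.
  rewrite hv //; first exact: cstar_genB.
  by rewrite (star_homB pi_hom) // mult // !pL EE eqxx scale1r subrr.
pose W : 'M[C]_(m, n) := \matrix_(l, j) (L (E j o) *m w) l 0.
have colW j : col j W = L (E j o) *m w by apply/colP=> l; rewrite !mxE.
exists W.
  apply/matrixP=> a b.
  have -> : (adj W *m W) a b = dot (col b W) (col a W).
    by rewrite /dot !mxE; apply: eq_bigr => l _; rewrite !mxE.
  rewrite !colW -dot_adjr mulmxA.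
  have Da : D (adj (L (E a o))) by apply: cg_adj.
  (* Under [pi] the product on the left becomes [E o a *m E b o], which is [E o o] or 0. *)
  rewrite (@eqw _ ((a == b)%:R *: L (E o o))).
  - by rewrite -scalemxAl Lw dotZl w1 mulr1 !mxE.
  - exact: cg_mul.
  - exact: cg_scale.
  - rewrite mult // star // (star_homZ pi_hom) // !pL.
    have -> : adj (E a o) = E o a.
      by apply/matrixP=> x y; rewrite adjE !mxE conjC_nat andbC.
    by rewrite EE.
move=> Y DY; apply/matrixP=> l j.
have -> : (Y *m W) l j = (Y *m (L (E j o) *m w)) l 0.
  by rewrite -colW mulmx_col [RHS]mxE.
have DF k : D (pi Y k j *: L (E k o)) by apply: cg_scale.
have [DS pS] := star_hom_sum pi_hom (index_enum 'I_n) DF.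
rewrite mulmxA (@eqw _ (\sum_k pi Y k j *: L (E k o))) //.
- rewrite mulmx_suml summxE mxE; apply: eq_bigr => k _.
  by rewrite -scalemxAl mxE [in RHS]mxE mulrC.
- exact: cg_mul.
- rewrite mult // pL pS; apply/matrixP=> x y; rewrite mxE summxE (bigD1 j) //= big1 ?addr0.
    rewrite (bigD1 x) //= big1 ?addr0 => [|k kx].
      by rewrite (star_homZ pi_hom) // pL !mxE !eqxx /=; case: (y == o); rewrite ?mulr1 ?mulr0.
    by rewrite (star_homZ pi_hom) // pL !mxE eq_sym (negPf kx) mulr0.
  by move=> k kj; rewrite mxE (negPf kj) mulr0.
Qed.

End Compression.

(** The columns of [Q] come from Gram-Schmidt on the left kernel of [W]. The isometry [[W Q]] is
    square because [n + p = m], hence unitary. *)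
Lemma isometry_complement n m (W : 'M[C]_(m, n)) : adj W *m W = 1%:M ->
  exists p, (n + p)%N = m /\ exists Q : 'M[C]_(m, p),
    [/\ adj Q *m Q = 1%:M, adj Q *m W = 0, adj W *m Q = 0 &
        W *m adj W + Q *m adj Q = 1%:M].
Proof.
move=> WW; pose p := \rank (kermx W).
have rW : \rank W = n.
  by apply/eqP; rewrite eqn_leq rank_leq_col -{1}(mxrank1 C n) -WW mxrankM_maxr.
have np : (n + p)%N = m.
  have : (n <= m)%N by rewrite -rW rank_leq_row.
  by rewrite /p mxrank_ker rW => ?; rewrite subnKC.
exists p; split=> //.
pose Q' := schmidt (row_base (kermx W)).
have pm : (p <= m)%N by apply: rank_leq_col.
have uQ : Q' *m adj Q' = 1%:M.
  by have -> : adj Q' = map_mx Num.conj Q'^T;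
    [apply/matrixP=> i j; rewrite !mxE | apply/unitarymxP/schmidt_unitarymx].
have QW : Q' *m W = 0.
  apply/sub_kermxP; rewrite eqmx_schmidt_free ?eq_row_base ?row_base_free //.
exists (adj Q'); rewrite !adjK; split=> //.
  by rewrite -[LHS]adjK adjM !adjK QW adj0.
have UU : adj (row_mx W (adj Q')) *m row_mx W (adj Q') = 1%:M.
  rewrite adj_row_mx adjK mul_col_row WW QW uQ -[adj W *m adj Q']adjK adjM !adjK QW adj0.
  by rewrite -scalar_mx_block.
have mp : (m <= n + p)%N by rewrite np.
have [_ /(_ mp)] := mulmx1_rev UU; rewrite adj_row_mx adjK.
by rewrite mul_row_col.
Qed.

End StarHomomorphism.

(** * From the envelope hypothesis to the decomposition *)

Section Envelope.
Variable R : realType.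
Local Notation C := R[i].
Set Implicit Arguments. Unset Strict Implicit.

Lemma castmx_conj r p q (e : p = q) (U : 'M[C]_(r, p)) (A : 'M[C]_p) :
  castmx (erefl r, e) U *m castmx (e, e) A *m adj (castmx (erefl r, e) U) = U *m A *m adj U.
Proof. by case: q / e; rewrite !castmx_id. Qed.

Lemma castmx_gram r p q (e : p = q) (U : 'M[C]_(r, p)) :
  castmx (erefl r, e) U *m adj (castmx (erefl r, e) U) = U *m adj U.
Proof. by case: q / e; rewrite !castmx_id. Qed.

Lemma cenvelope_isometry n m (phi : 'M[C]_n -> 'M[C]_m) : (0 < n)%N ->
  linear_on (@inToeplitz R n) phi -> phi 1%:M = 1%:M ->
  isometry_on (@inToeplitz R n) phi ->
  cenvelope_is_Mn (image_of (@inToeplitz R n) phi) n ->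
  exists2 W : 'M[C]_(m, n), adj W *m W = 1%:M & forall X, inToeplitz X ->
    phi X *m W = W *m X /\ adj W *m phi X = X *m adj W.
Proof.
move=> n_gt0 phi_lin phi1 phi_iso [iota [[iota_lin iota1 iota_iso] _ univ]].
have im X : inToeplitz X -> image_of (@inToeplitz R n) phi (phi X) by exists X.
have comp_lin : linear_on (@inToeplitz R n) (iota \o phi).
  by move=> a X Y XT YT; rewrite /= phi_lin // iota_lin //; apply: im.
have comp_iso : isometry_on (@inToeplitz R n) (iota \o phi).
  move=> X XT; rewrite -(phi_iso X XT) /= -!ampnorm1.
  exact: (iota_iso 1%N (fun _ _ => phi X) (fun _ _ => im _ XT)).
have comp1 : (iota \o phi) 1%:M = 1%:M by rewrite /= phi1.
have [V [VV VV' iotaE]] := toeplitz_isometry_rigid n_gt0 comp_lin comp1 comp_iso (leqnn n).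
(* The universal property, applied to the inclusion of [phi(A)], gives a homomorphism from the
   algebra it generates onto [M_n]. *)
have [|pi [pi_hom piE]] := univ m id; first by split.
have [W WW hW] := star_hom_compression n_gt0 pi_hom.
have [_ _ star _ _] := pi_hom.
have gen X : inToeplitz X -> cstar_gen (image_of (image_of (@inToeplitz R n) phi) id) (phi X).
  by move=> XT; apply: cg_gen; exists (phi X) => //; apply: im.
have piphi X : inToeplitz X -> pi (phi X) = V *m X *m adj V.
  by move=> XT; have := piE _ (im _ XT) => /= ->; apply: iotaE.
exists (W *m V); first by rewrite adjM -mulmxA [adj W *m _]mulmxA WW mul1mx.
move=> X XT; split.
  by rewrite mulmxA hW ?piphi; [rewrite -!mulmxA VV mulmx1 | | exact: gen].
(* The second relation is the adjoint of an intertwining relation for [adj (phi X)]. *)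
apply: (can_inj (@adjK R _ _)); rewrite !adjM !adjK mulmxA hW; last by apply/cg_adj/gen.
by rewrite star ?piphi ?adjM ?adjK; [rewrite -!mulmxA VV mulmx1 | | exact: gen].
Qed.

End Envelope.

Theorem theorem6p1 (R : realType) (n m : nat) (n_gt0 : (0 < n)%N)
    (phi : 'M[R[i]]_n -> 'M[R[i]]_m) :
  linear_on (@inToeplitz R n) phi ->
  phi 1%:M = 1%:M ->
  isometry_on (@inToeplitz R n) phi ->
  (n <= m)%N /\
  (cenvelope_is_Mn (image_of (@inToeplitz R n) phi) n ->
   exists (l p : nat) (e : (l * n + p)%N = m) (U : 'M[R[i]]_m)
          (psi : 'M[R[i]]_n -> 'M[R[i]]_p),
     [/\ (0 < l)%N, unitary U,
         [/\ linear_on (@inToeplitz R n) psi, psi 1%:M = 1%:M &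
              contraction_on (@inToeplitz R n) psi] &
         forall X, inToeplitz X ->
           phi X = U *m castmx (e, e) (block_mx ((1%:M : 'M_l) *t X) 0 0 (psi X))
                     *m adj U]).
Proof.
move=> phi_lin phi1 phi_iso; split; first exact: toeplitz_isometry_dim phi_lin phi1 phi_iso.
move=> env; have [W WW hW] := cenvelope_isometry n_gt0 phi_lin phi1 phi_iso env.
have [p [np [Q [QQ QW WQ sum1]]]] := isometry_complement WW.
(* One copy is split off, [l = 1]; the casts below identify [1 * n] with [n]. *)
have e : (1 * n + p)%N = m by rewrite mul1n.
pose e1 := esym (mul1n n).
pose U0 := row_mx (castmx (erefl m, e1) W) Q.
pose U := castmx (erefl m, e) U0.
pose psi X := adj Q *m phi X *m Q.
have UU : U *m adj U = 1%:M by rewrite castmx_gram adj_row_mx mul_row_col castmx_gram.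
exists 1%N, p, e, U, psi; split=> //.
- by split=> //; apply: mulmx1C.
- split.
  + move=> a X Y XT YT; rewrite /psi phi_lin // mulmxDr mulmxDl.
    by rewrite -scalemxAr -scalemxAl.
  + by rewrite /psi phi1 mulmx1.
  + move=> X XT; rewrite -(phi_iso X XT); apply: opnorm_le => [|x]; first exact: opnorm_ge0.
    (* [W W^* + Q Q^* = 1] makes [adj Q] a contraction. *)
    have adjQ y : dot (adj Q *m y) (adj Q *m y) <= dot y y.
      rewrite [leRHS](_ : _ = dot ((W *m adj W + Q *m adj Q) *m y) y); last first.
        by rewrite sum1 mul1mx.
      rewrite mulmxDl dotDl -!mulmxA [dot (W *m _) _]dot_adj [dot (Q *m _) _]dot_adj.
      by rewrite lerDr dot_ge0.
    rewrite /psi -!mulmxA; apply: le_trans (adjQ _) _.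
    apply: le_trans (opnorm_bound _ _) _.
    by rewrite [dot (Q *m _) _]dot_adj mulmxA QQ mul1mx.
move=> X XT; have [XW WX] := hW X XT.
rewrite castmx_conj /U0 mul_row_block !mulmx0 addr0 add0r adj_row_mx mul_row_col.
rewrite tens_scalar1mx castmx_conj.
(* The resolution of the identity is inserted on the right and then, in the [Q] part, on the left;
   the mixed term contains [adj W *m Q = 0]. *)
have {1}-> : phi X = phi X *m (W *m adj W + Q *m adj Q) by rewrite sum1 mulmx1.
rewrite mulmxDr !mulmxA XW; congr (_ + _).
have {1}-> : phi X = (W *m adj W + Q *m adj Q) *m phi X by rewrite sum1 mul1mx.
rewrite mulmxDl -[W *m adj W *m _]mulmxA WX /psi !mulmxDl -!mulmxA.
by rewrite [adj W *m (Q *m _)]mulmxA WQ mul0mx !mulmx0 add0r.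
Qed.
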